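(* Let $n\ge1$, $d\ge1$ be integers and let $\mathsf{M}_\alpha$ be a connected sparse paving matroid of rank $d+1$ on $\llbracket n\rrbracket=\{0,1,\ldots,n\}$ with exactly $\alpha$ circuit-hyperplanes. Then \[ \mathrm{Vol}(P_{\mathsf{M}_\alpha})=\frac{1}{n!}\left(A_{n,d}-\alpha\binom{n-1}{d}\right), \] where $A_{n,d}$ is the number of permutations of $[n]=\{1,\ldots,n\}$ with exactly $d$ descents.
   Context: $P_\mathsf{M}=\mathrm{conv}\{\sum_{i\in B}\mathbf{e}_i : B\text{ a basis of }\mathsf{M}\}\subseteq\mathbb{R}^{n+1}$ is the base polytope. $\mathrm{Vol}(P)$ denotes the volume of $P$ in its affine hull, normalised so that the unit hypercube in $\mathrm{aff}(P)$ has volume $1$. A matroid of rank $d+1$ is sparse paving if every $(d+1)$-subset of the ground set is either a basis or a circuit-hyperplane (a set that is both a circuit and a hyperplane). A descent of a permutation $w_1\cdots w_n$ is an index $i\in\{1,\ldots,n-1\}$ with $w_i>w_{i+1}$. *)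

(* Defs.v *)
From HB Require Import structures.
From mathcomp Require Import all_boot all_order all_algebra perm.

Set Implicit Arguments.
Unset Strict Implicit.
Unset Printing Implicit Defensive.

Import Order.TTheory GRing.Theory Num.Theory.

Record matroid (E : finType) := Matroid {
  bases : {set {set E}};
  bases_neq0 : bases != set0;
  bases_exchange : forall B1 B2 : {set E}, B1 \in bases -> B2 \in bases ->
    forall x, x \in B1 :\: B2 ->
    exists2 y, y \in B2 :\: B1 & y |: (B1 :\ x) \in bases }.

Section MatroidNotions.
Variables (E : finType) (M : matroid E).
Implicit Types S C H I : {set E}.

Definition independent I : bool := [exists B in bases M, I \subset B].

Definition rk S : nat := \max_(I : {set E} | independent I && (I \subset S)) #|I|.

Definition matroid_rank : nat := rk [set: E].

Definition circuit C : bool := minset (fun S => ~~ independent S) C.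

Definition matroid_closure S : {set E} := [set x | rk (x |: S) == rk S].

Definition is_flat S : bool := matroid_closure S == S.

Definition hyperplane H : bool := is_flat H && ((rk H).+1 == matroid_rank).

Definition circuit_hyperplane S : bool := circuit S && hyperplane S.

Definition circuit_hyperplanes : {set {set E}} := [set S | circuit_hyperplane S].

Definition sparse_paving : Prop :=
  forall S, #|S| = matroid_rank -> (S \in bases M) \/ circuit_hyperplane S.

Definition connected_matroid : Prop :=
  forall x y : E, x != y -> exists C, [/\ circuit C, x \in C & y \in C].

End MatroidNotions.

(* The word w_1 ... w_n of w : 'S_n is w 0, ..., w (n - 1); i is a descent when
   it has a successor j in 'I_n and w j < w i. *)
Definition descents (n : nat) (w : 'S_n) : {set 'I_n} :=
  [set i : 'I_n | [exists j : 'I_n, (nat_of_ord j == i.+1) && (w j < w i)]].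

Definition eulerian (n d : nat) : nat := #|[set w : 'S_n | #|descents w| == d]|.

From mathcomp Require Import all_classical all_reals all_analysis.

Local Open Scope classical_set_scope.
Local Open Scope ring_scope.

Section Volume.
Variable R : realType.

Definition conv_hull (m : nat) (A : set 'rV[R]_m) : set 'rV[R]_m :=
  [set x | exists (k : nat) (c : 'I_k -> R) (v : 'I_k -> 'rV[R]_m),
    [/\ forall i, A (v i), forall i, 0 <= c i, \sum_i c i = 1
      & x = \sum_i c i *: v i]].

Definition aff_hull (m : nat) (A : set 'rV[R]_m) : set 'rV[R]_m :=
  [set x | exists (k : nat) (c : 'I_k -> R) (v : 'I_k -> 'rV[R]_m),
    [/\ forall i, A (v i), \sum_i c i = 1 & x = \sum_i c i *: v i]].

(* Lebesgue measure on R^k, as the iterated product measure. *)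
Fixpoint lebesgue_tuple (k : nat) : set (k.-tuple R) -> \bar R :=
  match k with
  | 0 => \d_([tuple] : 0.-tuple R)
  | k'.+1 =>
    pushforward (@lebesgue_measure R \x @lebesgue_tuple k')%E
      (fun p : R * k'.-tuple R =>
         [tuple of p.1 :: p.2])
  end.

Definition affine_param (k m : nat) (p : 'rV[R]_m) (B : 'M[R]_(k, m))
    (t : k.-tuple R) : 'rV[R]_m :=
  p + \sum_(i < k) tnth t i *: row i B.

Definition lattice_points (m : nat) : set 'rV[R]_m :=
  [set x | forall j, x ord0 j \is a Num.int].

(* t |-> p + t B is an affine isomorphism from R^k onto A which maps Z^k onto
   the lattice points of A. *)
Definition lattice_frame (k m : nat) (A : set 'rV[R]_m)
    (p : 'rV[R]_m) (B : 'M[R]_(k, m)) : Prop :=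
  [/\ row_free B,
      affine_param p B @` setT = A
    & affine_param p B @` [set t | forall i, tnth t i \is a Num.int]
      = A `&` @lattice_points m].

(* Volume of P in aff P, where the unit hypercube of aff P is the image of
   [0, 1]^k under a lattice frame, i.e. a fundamental cell of the lattice of
   integer points of aff P.  Two lattice frames differ by an integral affine
   map of determinant 1 or -1, so for a Borel set P the set below has at most one
   element; it is empty, and the volume 0 by convention, when aff P is not
   spanned by its integer points. *)
Definition Vol (m : nat) (P : set 'rV[R]_m) : \bar R :=
  xget 0%E [set v : \bar R |
    exists (k : nat) (p : 'rV[R]_m) (B : 'M[R]_(k, m)),
      lattice_frame (aff_hull P) p B /\
      v = lebesgue_tuple (affine_param p B @^-1` P)].

Definition base_polytope (m : nat) (M : matroid 'I_m) : set 'rV[R]_m :=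
  conv_hull [set v | exists2 B : {set 'I_m},
    B \in bases M & v = \sum_(i in B) delta_mx ord0 i].

End Volume.

Arguments base_polytope R {m} M.

(* Main.v *)
(** Choosing the last coordinate as dependent one identifies the hyperplane
    [sum x = d + 1] with [R^n], compatibly with the lattices.  Lebesgue measure is
    scaled by [|det|] under linear maps (Gaussian elimination reduces this to Fubini and
    the one-dimensional case), so every lattice frame computes the same volume.

    An r-set that is not a basis is a circuit-hyperplane, and two of these share at most
    [r - 2] elements.  Hence a non-integral point of the hypersimplex cut by the
    inequalities [x(S) <= d], for [S] a circuit-hyperplane, can be moved in both directions
    along some [e_a - e_b] until a new inequality becomes tight, and the base polytope is
    exactly this cut hypersimplex.  The pieces [x(S) > d] cut off are pairwise disjoint.

    The cube is, up to a null set, the disjoint union of the [n!] simplices given by the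
    relative order of the coordinates, each of volume [1 / n!].  Stanley's map sends
    [t] to the fractional parts of its partial sums; it preserves the measure, and the
    integral part of [sum t] becomes the number of descents of the order pattern, so the
    hypersimplex has volume [A_{n,d} / n!].  Partial sums of [1 - t_i] over [S] and of
    [t_i] off [S] turn a piece that is cut off into the union of the simplices of the
    permutations that increase on both blocks and are maximal at the end of the first, and
    there are [binomial (n - 1) d] of these. *)

From HB Require Import structures.
Require Import Defs.
From mathcomp Require Import all_boot all_order all_algebra perm.
From mathcomp Require Import all_classical all_reals all_analysis.
From mathcomp Require Import measurable_realfun ring lra zify.

Set Implicit Arguments.
Unset Strict Implicit.
Unset Printing Implicit Defensive.

Import Order.TTheory GRing.Theory Num.Theory.
Local Open Scope classical_set_scope.
Local Open Scope ring_scope.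

(** * Matroids *)

Section MatroidFacts.
Local Open Scope nat_scope.
Variables (E : finType) (M : matroid E).
Implicit Types (B I S C : {set E}).

Lemma bases_subset_eq B1 B2 : B1 \in bases M -> B2 \in bases M ->
  B1 \subset B2 -> B1 = B2.
Proof.
move=> b1 b2 s12; apply/eqP; rewrite finset.eqEsubset s12 /=.
apply/fintype.subsetP => x xB2; apply: contraT => xB1.
have [|y] := bases_exchange b2 b1 (x := x); first by rewrite inE xB1.
by rewrite inE => /andP[/negP yB2 /(fintype.subsetP s12)].
Qed.

(** Induction on the size of [B1 :\: B2]: exchanging [x] for [y] preserves the cardinality of [B1]
    and brings it one element closer to [B2]. *)
Lemma bases_card B1 B2 : B1 \in bases M -> B2 \in bases M -> #|B1| = #|B2|.
Proof.
move=> b1 b2; have [m] := ubnP #|B1 :\: B2|; elim: m => // m IH in B1 b1 *.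
rewrite ltnS => lem.
have [s12|/subsetPn[x xB1 xB2]] := boolP (B1 \subset B2).
  by rewrite (bases_subset_eq b1 b2 s12).
have [|y yB b] := bases_exchange b1 b2 (x := x); first by rewrite inE xB2.
move: yB; rewrite inE => /andP[yB1 yB2].
have cE : #|y |: B1 :\ x| = #|B1|.
  by rewrite cardsU1 (cardsD1 x B1) xB1 !inE (negbTE yB1) andbF.
rewrite -cE; apply: IH => //; apply: leq_trans lem.
apply: proper_card; apply/properP; split.
  apply/fintype.subsetP => z; rewrite !inE => /andP[zB2 /orP[/eqP zy|/andP[_ ->]]].
    by move: zB2; rewrite zy yB2.
  by rewrite zB2.
exists x; rewrite !inE ?xB2 ?xB1 // eqxx /= orbF.
by apply: contraNneq xB2 => ->.
Qed.

Lemma independentP I : reflect (exists2 B, B \in bases M & I \subset B) (independent M I).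
Proof. exact: exists_inP. Qed.

Lemma independent_sub I S : I \subset S -> independent M S -> independent M I.
Proof.
move=> IS /independentP[B bB SB]; apply/independentP; exists B => //.
exact: fintype.subset_trans SB.
Qed.

Lemma basis_independent B : B \in bases M -> independent M B.
Proof. by move=> bB; apply/independentP; exists B. Qed.

Lemma rk_ge I S : independent M I -> I \subset S -> #|I| <= rk M S.
Proof. by move=> iI IS; rewrite /rk (bigop.bigmax_sup I) // iI. Qed.

Lemma rk_attained S : exists2 I, independent M I && (I \subset S) & #|I| = rk M S.
Proof.
have [B bB] := set0Pn _ (bases_neq0 M).
have i0 : independent M finset.set0 && (finset.set0 \subset S).
  rewrite finset.sub0set andbT; apply: independent_sub (basis_independent bB).
  exact: finset.sub0set.
rewrite /rk (bigop.bigmax_eq_arg finset.set0) //.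
by case: arg_maxnP => // I iI _; exists I.
Qed.

Lemma basis_rank B : B \in bases M -> #|B| = matroid_rank M.
Proof.
move=> bB; have [I /andP[/independentP[B' bB' IB'] _] cI] := rk_attained [set: E]%SET.
apply/eqP; rewrite eqn_leq rk_ge ?finset.subsetT ?basis_independent //=.
by rewrite /matroid_rank -cI (bases_card bB bB') subset_leq_card.
Qed.

Lemma independent_card_basis I :
  independent M I -> matroid_rank M <= #|I| -> I \in bases M.
Proof.
move=> /independentP[B bB IB] rI.
suff -> : I = B by [].
by apply/eqP; rewrite eqEcard IB (basis_rank bB).
Qed.

(* A basis extending [I] and meeting [I :|: B] as much as possible stays inside it, by exchange. *)
Lemma basis_extension I B : independent M I -> B \in bases M ->
  exists2 B', B' \in bases M & (I \subset B') && (B' \subset I :|: B).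
Proof.
move=> /independentP[B0 bB0 IB0] bB.
pose P B' := (B' \in bases M) && (I \subset B').
have P0 : P B0 by rewrite /P bB0.
case: (@arg_minnP _ B0 P (fun B' => #|B' :\: (I :|: B)|) P0) => B' /andP[bB' IB'] min.
exists B' => //; rewrite IB' /=; apply/fintype.subsetP => x xB'; apply: contraT => xIB.
have [xI xB] : x \notin I /\ x \notin B by move: xIB; rewrite inE negb_or => /andP.
have [|y yB b] := bases_exchange bB' bB (x := x); first by rewrite inE xB.
have : P (y |: B' :\ x).
  rewrite /P b; apply/fintype.subsetP => z zI; rewrite !inE (fintype.subsetP IB') // andbT.
  by apply/orP; right; apply: contraNneq xI => <-.
move/min; rewrite leqNgt => /negP; case.
apply: proper_card; apply/properP; split.
  apply/fintype.subsetP => z; rewrite !inE => /andP[zIB /orP[/eqP zy|/andP[_ ->]]].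
    by move: zIB yB; rewrite zy !inE negb_or => /andP[_ /negbTE ->]; rewrite andbF.
  by rewrite zIB.
exists x; first by rewrite inE xIB.
move: yB; rewrite !inE eqxx /= => /andP[yB' _].
by rewrite orbF; apply/negP => /andP[_ /eqP xy]; rewrite -xy xB' in yB'.
Qed.

Lemma circuit_dependent C : circuit M C -> ~~ independent M C.
Proof. by move=> /minsetp. Qed.

Lemma circuit_proper C I : circuit M C -> I \proper C -> independent M I.
Proof.
move=> /minsetP[_ min] /properP[IC [x xC xI]]; apply: contraT => dI.
by rewrite -(min I dI IC) (negbTE xI) in xC.
Qed.

Lemma circuit_neq0 C : circuit M C -> exists x, x \in C.
Proof.
move=> cC; apply/set0Pn; apply: contraNneq (circuit_dependent cC) => ->.
have [B bB] := set0Pn _ (bases_neq0 M).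
apply: independent_sub (basis_independent bB); exact: finset.sub0set.
Qed.

Lemma circuit_rk C : circuit M C -> (rk M C).+1 = #|C|.
Proof.
move=> cC; have [x xC] := circuit_neq0 cC.
rewrite [RHS](cardsD1 x) xC add1n; congr _.+1; apply/eqP; rewrite eqn_leq.
rewrite [X in _ && X]rk_ge ?subD1set ?(circuit_proper cC) ?properD1 // andbT.
have [I /andP[iI IC] <-] := rk_attained C.
have : I \proper C.
  rewrite finset.properEneq IC andbT; apply: contraNneq (circuit_dependent cC) => <-.
  exact: iI.
by move/proper_card; rewrite (cardsD1 x C) xC.
Qed.

Lemma circuit_hyperplane_card S : circuit_hyperplane M S -> #|S| = matroid_rank M.
Proof. by move=> /andP[cS /andP[_ /eqP <-]]; rewrite circuit_rk. Qed.

Lemma circuit_hyperplane_not_basis S : circuit_hyperplane M S -> S \notin bases M.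
Proof.
move=> /andP[cS _]; apply: contra (circuit_dependent cS); exact: basis_independent.
Qed.

(** Otherwise [S] and [S'] are I + x and I + y for a common independent set I. As [S] is flat, I + x
    + y contains a basis [B]; as neither [S] nor [S'] is a basis, I extends to a basis I + z with z
    outside [B]. Exchanging z against [B] brings in x or y, and so turns [S] or [S'] into a
    basis. *)
Lemma circuit_hyperplane_meet S S' : circuit_hyperplane M S ->
  circuit_hyperplane M S' -> S != S' -> #|S :&: S'| + 2 <= matroid_rank M.
Proof.
move=> hS hS' SS'; have cS := circuit_hyperplane_card hS.
have cS' := circuit_hyperplane_card hS'.
have [circS /andP[flatS /eqP rkS]] := andP hS.
have [circS' _] := andP hS'.
have [x xS xS'] : exists2 x, x \in S & x \notin S'.
  apply/subsetPn; apply: contra SS' => s; by rewrite eqEcard s cS cS' leqnn.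
have [y yS' yS] : exists2 y, y \in S' & y \notin S.
  apply/subsetPn; apply: contra SS' => s; by rewrite eq_sym eqEcard s cS cS' leqnn.
rewrite leqNgt; apply/negP => meet_big.
have IS : S :&: S' = S :\ x.
  apply/eqP; rewrite eqEcard; apply/andP; split.
    apply/fintype.subsetP => z; rewrite !inE => /andP[-> zS']; rewrite andbT.
    by apply: contraNneq xS' => <-.
  by move: meet_big; rewrite -cS (cardsD1 x S) xS add1n addn2 !ltnS.
have IS' : S :&: S' = S' :\ y.
  apply/eqP; rewrite eqEcard; apply/andP; split.
    apply/fintype.subsetP => z; rewrite !inE => /andP[zS ->]; rewrite andbT.
    by apply: contraNneq yS => <-.
  by move: meet_big; rewrite -cS' (cardsD1 y S') yS' add1n addn2 !ltnS.
(* [S] is closed, so adding [y] raises its rank to that of the matroid. *)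
have [B bB BS] : exists2 B, B \in bases M & B \subset y |: S.
  have [I /andP[iI IyS] cI] := rk_attained (y |: S).
  exists I => //; apply: independent_card_basis => //; rewrite cI -rkS.
  rewrite ltn_neqAle; apply/andP; split.
    move: yS; rewrite -{1}(eqP flatS) inE; apply: contra => /eqP ->; exact/eqP.
  have [J /andP[iJ JS] <-] := rk_attained S.
  by apply: rk_ge => //; apply: fintype.subset_trans JS (finset.subsetUr _ _).
have iI : independent M (S :\ x) by apply: (circuit_proper circS); exact: properD1.
have [B' bB' IB'] := independentP _ iI.
have [z zB' zI] : exists2 z, z \in B' & z \notin S :\ x.
  apply/subsetPn; apply/negP => s; have := subset_leq_card s.
  by rewrite (basis_rank bB') -cS (cardsD1 x S) xS add1n ltnn.
have B'E : B' = z |: (S :\ x).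
  apply/esym/eqP; rewrite eqEcard finset.subUset finset.sub1set zB' IB' /=.
  by rewrite cardsU1 zI (basis_rank bB') -cS (cardsD1 x S) xS.
have zx : z != x.
  apply: contraNneq (circuit_hyperplane_not_basis hS) => zx.
  by have -> : S = B' by rewrite B'E zx finset.setD1K.
have zy : z != y.
  apply: contraNneq (circuit_hyperplane_not_basis hS') => zy.
  by have -> : S' = B' by rewrite B'E zy -IS IS' finset.setD1K.
have zB : z \notin B.
  apply/negP => /(fintype.subsetP BS); rewrite !inE (negbTE zy) /= => zS.
  by move: zI; rewrite !inE zx zS.
(* Every element of [B] outside [S :\ x] is [x] or [y], so the exchange can only produce [S] or
   [S']. *)
have [|b bin bas] := bases_exchange bB' bB (x := z); first by rewrite inE zB.
have D1 : B' :\ z = S :\ x by rewrite B'E finset.setU1K.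
move: bas; rewrite D1.
move: bin; rewrite !inE => /andP[bB'n /(fintype.subsetP BS)]; rewrite !inE => /orP[/eqP ->|bS].
  rewrite -IS IS' finset.setD1K //; apply/negP; exact: circuit_hyperplane_not_basis.
have -> : b = x.
  by apply/eqP; apply: contraNT bB'n => bx; rewrite B'E !inE bx bS orbT.
rewrite finset.setD1K //; apply/negP; exact: circuit_hyperplane_not_basis.
Qed.

(** Take a circuit [C] through [i] and [j]. A basis [B] containing [C :\ i] misses [i]; a basis
    containing [C :\ j] and lying in its union with [B] misses [j], and a count shows that it is
    [i |: B :\ j]. The difference of the two bases makes the vector e_i - e_j a direction of the
    affine hull. *)
Lemma connected_exchange : connected_matroid M -> forall i j : E, i != j ->
  exists2 B, B \in bases M & [/\ i \notin B, j \in B & i |: B :\ j \in bases M].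
Proof.
move=> conn i j ij; have [C [cC iC jC]] := conn i j ij.
have iCi : independent M (C :\ i) by apply: (circuit_proper cC); exact: properD1.
have [B bB CB] := independentP _ iCi.
have jB : j \in B by apply: (fintype.subsetP CB); rewrite !inE eq_sym ij.
have iB : i \notin B.
  apply: contra (circuit_dependent cC) => iB; apply/independentP; exists B => //.
  apply/fintype.subsetP => z zC; have [->//|zi] := eqVneq z i.
  by apply: (fintype.subsetP CB); rewrite !inE zi.
exists B => //; split => //.
have iCj : independent M (C :\ j) by apply: (circuit_proper cC); exact: properD1.
have [B' bB' /andP[CB' B'CB]] := basis_extension iCj bB.
suff <- : B' = i |: B :\ j by [].
have jB' : j \notin B'.
  apply: contra (circuit_dependent cC) => jB'; apply/independentP; exists B' => //.
  apply/fintype.subsetP => z zC; have [->//|zj] := eqVneq z j.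
  by apply: (fintype.subsetP CB'); rewrite !inE zj.
apply/eqP; rewrite eqEcard; apply/andP; split.
  apply/fintype.subsetP => z zB'; rewrite !inE.
  have zj : z != j by apply: contraNneq jB' => <-.
  have := fintype.subsetP B'CB z zB'; rewrite !inE zj /= => /orP[zC|->]; last by rewrite orbT.
  have [//|zi] := eqVneq z i; apply: (fintype.subsetP CB).
  by rewrite !inE zi.
by rewrite cardsU1 !inE (negbTE iB) andbF (bases_card bB' bB) [#|B|](cardsD1 j) jB.
Qed.

End MatroidFacts.

(** * Lebesgue measure on tuples *)

Section LebesgueTuple.
Variable R : realType.
Local Notation leb := (@lebesgue_measure R).

Definition ctuple (k : nat) (p : measurableTypeR R * k.-tuple R) : k.+1.-tuple R :=
  [tuple of p.1 :: p.2].

Lemma measurable_ctuple k : measurable_fun setT (@ctuple k).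
Proof.
by apply: measurable_cons; [exact: measurable_fst | exact: measurable_snd].
Qed.

Lemma measurable_uncons k : measurable_fun setT
  (fun t : k.+1.-tuple R => (thead t : measurableTypeR R, [tuple of behead t])).
Proof.
apply: measurable_fun_pair; last exact: measurable_behead.
exact: measurable_tnth.
Qed.

Section ConsMeasure.
Variables (k : nat) (m : {sigma_finite_measure set (k.-tuple R) -> \bar R}).

Definition cons_measure : set (k.+1.-tuple R) -> \bar R :=
  pushforward (leb \x m)%E (@ctuple k).

HB.instance Definition _ := Measure.copy cons_measure
  (measure_function_pushforward__canonical__measure_function_Measure
     (leb \x m)%E (@measurable_ctuple k)).

Let cons_measure_sigma_finite : sigma_finite setT cons_measure.
Proof.
have /sigma_finiteP[F [TF ndF Foo]] := sigma_finiteT leb.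
have /sigma_finiteP[G [TG ndG Goo]] := sigma_finiteT m.
pose uncons (t : k.+1.-tuple R) := (thead t : measurableTypeR R, [tuple of behead t]).
have unconsK p : uncons (ctuple p) = p.
  by case: p => x t; congr pair; apply/val_inj.
(* Both exhausting sequences increase, so the rectangles with a single index already cover the
   product. *)
exists (fun n => uncons @^-1` (F n `*` G n)).
  rewrite -preimage_bigcup (_ : \bigcup_n _ = setT) ?preimage_setT //.
  rewrite -setXTT TF TG predeqE => -[x y]; split.
    by move=> [i _ []/= ? ?]; split; exists i.
  move=> [/= [i _ Fnx] [j _ Gky]]; exists (maxn i j) => //; split.
    by move: x Fnx; exact/subsetPset/ndF/leq_maxl.
  by move: y Gky; exact/subsetPset/ndG/leq_maxr.
move=> n; have [mF Fn] := Foo n; have [mG Gn] := Goo n; split.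
  rewrite -[X in measurable X]setTI; apply: measurable_uncons => //.
  exact: measurableX.
rewrite /cons_measure /pushforward (_ : _ @^-1` _ = F n `*` G n); last first.
  have uc : uncons \o @ctuple k = id by apply/funext => p; exact: unconsK.
  by rewrite -comp_preimage uc.
by rewrite product_measure1E // lte_mul_pinfty // ge0_fin_numE.
Qed.

HB.instance Definition _ := Measure_isSigmaFinite.Build _ _ _
  cons_measure cons_measure_sigma_finite.

End ConsMeasure.

(** Prefixing a coordinate yields a measure once the tail measure is sigma-finite, so both
    properties go through the induction together. *)
Lemma lebesgue_tuple_measureP k :
  exists m : {sigma_finite_measure set (k.-tuple R) -> \bar R},
    @lebesgue_tuple R k = m.
Proof.
elim: k => [|k [m IH]]; first by exists \d_([tuple] : 0.-tuple R).
by exists (cons_measure m); rewrite /= IH.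
Qed.

Lemma lebesgue_tuple_set0 k : lebesgue_tuple (@set0 (k.-tuple R)) = 0%E.
Proof. by have [m ->] := lebesgue_tuple_measureP k; exact: measure0. Qed.

Lemma lebesgue_tuple_ge0 k (A : set (k.-tuple R)) : (0 <= lebesgue_tuple A)%E.
Proof. by have [m ->] := lebesgue_tuple_measureP k; exact: measure_ge0. Qed.

Lemma lebesgue_tuple_sigma_additive k : semi_sigma_additive (@lebesgue_tuple R k).
Proof.
by have [m ->] := lebesgue_tuple_measureP k; exact: measure_semi_sigma_additive.
Qed.

HB.instance Definition _ k := isMeasure.Build _ _ _ (@lebesgue_tuple R k)
  (lebesgue_tuple_set0 k) (@lebesgue_tuple_ge0 k) (@lebesgue_tuple_sigma_additive k).

Lemma lebesgue_tuple_sigma_finite k : sigma_finite setT (@lebesgue_tuple R k).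
Proof. by have [m ->] := lebesgue_tuple_measureP k; exact: sigma_finiteT. Qed.

HB.instance Definition _ k := Measure_isSigmaFinite.Build _ _ _
  (@lebesgue_tuple R k) (lebesgue_tuple_sigma_finite k).

Local Notation lebt := (@lebesgue_tuple R).

Lemma lebesgue_tupleS k (A : set (k.+1.-tuple R)) :
  lebt A = (\int[leb]_x lebt [set t | A (ctuple (x, t))])%E.
Proof.
rewrite /= /pushforward /product_measure1; apply: eq_integral => x _ /=.
by congr lebesgue_tuple; apply/seteqP; split => t; rewrite /xsection /= inE.
Qed.

Lemma measurable_preimage_ctuple k (A : set (k.+1.-tuple R)) :
  measurable A -> measurable (@ctuple k @^-1` A).
Proof. by move=> mA; rewrite -[X in measurable X]setTI; exact: measurable_ctuple. Qed.

Lemma measurable_section k (A : set (k.+1.-tuple R)) x :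
  measurable A -> measurable [set t | A (ctuple (x, t))].
Proof.
move=> /measurable_preimage_ctuple/(measurable_xsection x).
by congr measurable; apply/seteqP; split => t; rewrite /xsection /= inE.
Qed.

Lemma measurable_fun_section k (A : set (k.+1.-tuple R)) :
  measurable A ->
  measurable_fun setT (fun x : measurableTypeR R => lebt [set t | A (ctuple (x, t))]).
Proof.
move=> /measurable_preimage_ctuple mA.
have := @measurable_fun_xsection _ _ _ _ _ (@lebesgue_tuple R k) _ mA.
apply: eq_measurable_fun => x _ /=.
by congr lebesgue_tuple; apply/seteqP; split => t; rewrite /xsection /= inE.
Qed.

(** The two iterated integrals agree on rectangles, so by uniqueness of the product measure the
    first coordinate may be integrated innermost. This is the order suited to shears of that
    coordinate. *)
Lemma lebesgue_tuple_fubini k (A : set (k.+1.-tuple R)) : measurable A ->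
  lebt A = (\int[@lebesgue_tuple R k]_t leb [set x | A (ctuple (x, t))])%E.
Proof.
move=> /measurable_preimage_ctuple mA.
have -> : lebt A = (leb \x @lebesgue_tuple R k)%E (@ctuple k @^-1` A) by [].
rewrite (@product_measure_unique _ _ _ _ _ leb (@lebesgue_tuple R k)
  (leb \x^ @lebesgue_tuple R k)%E) //; last first.
  by move=> A1 A2 mA1 mA2 /=; rewrite product_measure2E.
rewrite /= /product_measure2; apply: eq_integral => t _ /=.
by congr lebesgue_measure; apply/seteqP; split => x; rewrite /ysection /= inE.
Qed.

Lemma measurable_affine1 (a b : R) :
  measurable_fun setT (fun x : measurableTypeR R => (a * x + b : measurableTypeR R)).
Proof.
exact: measurable_funD.
Qed.

(** Uniqueness of Lebesgue measure reduces the claim to half-open intervals. *)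
Lemma lebesgue_measure_affine (a b : R) (A : set (measurableTypeR R)) :
  a != 0 -> measurable A ->
  leb A = (`|a|%:E * leb [set x | A (a * x + b)%R])%E.
Proof.
move=> a0 mA.
pose push : {measure set (measurableTypeR R) -> \bar R} :=
  measure_function_pushforward__canonical__measure_function_Measure leb
    (measurable_affine1 a b).
pose mu : {measure set (measurableTypeR R) -> \bar R} := mscale (NngNum (normr_ge0 a)) push.
rewrite (@lebesgue_measure_unique _ mu) // => _ [[p q] _ <-].
rewrite /mu /= /mscale /= /pushforward.
have [a_gt0|a_lt0|a00] := ltgtP 0 a; last by rewrite -a00 eqxx in a0.
  rewrite (_ : _ @^-1` _ = `](p - b) / a, (q - b) / a]%classic); last first.
    apply/seteqP; split => x /=; rewrite !in_itv /= ltr_pdivrMr // ler_pdivlMr // ltrBlDr lerBrDr;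
    by rewrite mulrC.
  rewrite !lebesgue_measure_itv /= !lte_fin ltr_pM2r ?invr_gt0 // ltrD2r.
  case: ifP => _; last by rewrite mule0.
  rewrite -!EFinB -EFinM; congr EFin; rewrite gtr0_norm //; field.
  by rewrite gt_eqF.
(* For negative [a] the endpoints swap and the preimage is closed on the left instead of the
   right. *)
rewrite (_ : _ @^-1` _ = `[(q - b) / a, (p - b) / a[%classic); last first.
  apply/seteqP; split => x /=; rewrite !in_itv /= ler_ndivrMr // ltr_ndivlMr // ltrBlDr lerBrDr;
  by rewrite mulrC andbC.
rewrite !lebesgue_measure_itv /= !lte_fin ltr_nM2r ?invr_lt0 // ltrD2r.
case: ifP => _; last by rewrite mule0.
rewrite -!EFinB -EFinM; congr EFin; rewrite ltr0_norm //; field.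
by rewrite lt_eqF.
Qed.

Lemma integral_affine (a b : R) (f : measurableTypeR R -> \bar R) :
  a != 0 -> measurable_fun setT f -> (forall x, 0 <= f x)%E ->
  (`|a|%:E * \int[leb]_x f (a * x + b)%R = \int[leb]_x f x)%E.
Proof.
move=> a0 mf f0.
pose push : {measure set (measurableTypeR R) -> \bar R} :=
  measure_function_pushforward__canonical__measure_function_Measure leb
    (measurable_affine1 a b).
pose mu : {measure set (measurableTypeR R) -> \bar R} := mscale (NngNum (normr_ge0 a)) push.
rewrite [RHS](@eq_measure_integral _ _ _ _ mu); last first.
  by move=> A mA _; exact: lebesgue_measure_affine.
rewrite ge0_integral_mscale //= (ge0_integral_pushforward (measurable_affine1 a b)) //.
Qed.


(** * Affine maps and the determinant *)

Definition rowt k (t : k.-tuple R) : 'rV[R]_k := \row_i tnth t i.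
Definition tupr k (v : 'rV[R]_k) : k.-tuple R := [tuple v ord0 i | i < k].
(** Points are row vectors acted on from the right, so a composite corresponds to the product of the
    matrices in order of application. *)
Definition afft k l (U : 'M[R]_(k, l)) (c : 'rV[R]_l) (t : k.-tuple R) : l.-tuple R :=
  tupr (rowt t *m U + c).

Lemma rowtK k : cancel (@rowt k) (@tupr k).
Proof. by move=> t; apply: eq_from_tnth => i; rewrite tnth_mktuple mxE. Qed.

Lemma tuprK k : cancel (@tupr k) (@rowt k).
Proof. by move=> v; apply/rowP => i; rewrite mxE tnth_mktuple. Qed.

Lemma tnth_afft k l (U : 'M[R]_(k, l)) c (t : k.-tuple R) j :
  tnth (afft U c t) j = \sum_i tnth t i * U i j + c ord0 j.
Proof.
by rewrite tnth_mktuple !mxE; congr (_ + _); apply: eq_bigr => i _; rewrite mxE.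
Qed.

Lemma measurable_linear_form k (a : 'I_k -> R) (b : R) :
  measurable_fun setT (fun t : k.-tuple R => \sum_i tnth t i * a i + b).
Proof.
apply: measurable_funD => //; apply: measurable_sum => i.
by apply: measurable_funM => //; exact: measurable_tnth.
Qed.

Lemma measurable_afft k l (U : 'M[R]_(k, l)) c : measurable_fun setT (afft U c).
Proof.
apply/measurable_fun_tnthP => j.
have := @measurable_linear_form k (fun i => U i j) (c ord0 j).
by apply: eq_measurable_fun => t _ /=; rewrite tnth_afft.
Qed.

Lemma measurable_afft_preimage k l (U : 'M[R]_(k, l)) c (A : set (l.-tuple R)) :
  measurable A -> measurable (afft U c @^-1` A).
Proof. by move=> mA; rewrite -[X in measurable X]setTI; exact: measurable_afft. Qed.

Lemma rowt_ctuple k (x : R) (t : k.-tuple R) :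
  rowt (ctuple (x, t)) = row_mx x%:M (rowt t) :> 'rV_(1 + k).
Proof.
apply/rowP => i; rewrite !mxE.
case: splitP => j ij; rewrite !mxE.
  rewrite ord1 eqxx mulr1n.
  by rewrite (_ : i = ord0) ?tnth0 //; apply: val_inj; rewrite /= ij ord1.
by rewrite (_ : i = lift ord0 j) ?tnthS //; apply: val_inj.
Qed.

Lemma tupr_row_mx k (x : R) (v : 'rV[R]_k) :
  tupr (row_mx x%:M v : 'rV_(1 + k)) = ctuple (x, tupr v).
Proof.
by apply: (can_inj (@rowtK _)); rewrite rowt_ctuple tuprK tuprK.
Qed.

Lemma afft_comp k l m (U : 'M[R]_(k, l)) (V : 'M[R]_(l, m)) c e t :
  afft V e (afft U c t) = afft (U *m V) (c *m V + e) t.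
Proof. by rewrite /afft tuprK mulmxDl mulmxA addrA. Qed.

(** Phrased with preimages, the rule composes along matrix products without any inverse matrix. *)
Definition lebesgue_scaled k (U : 'M[R]_k) (c : 'rV[R]_k) :=
  forall A, measurable A ->
    (`|\det U|%:E * lebt (afft U c @^-1` A) = lebt A)%E.

Lemma lebesgue_scaledM k (U V : 'M[R]_k) c :
  lebesgue_scaled U 0 -> lebesgue_scaled V c -> lebesgue_scaled (U *m V) c.
Proof.
move=> hU hV A mA.
have -> : afft (U *m V) c @^-1` A = afft U 0 @^-1` (afft V c @^-1` A).
  by apply/seteqP; split => t /=; rewrite afft_comp mul0mx add0r.
rewrite det_mulmx normrM mulrC EFinM -muleA hU ?hV //.
exact: measurable_afft_preimage.
Qed.

(** For a fixed first coordinate [x] the tail undergoes [D] followed by a translation depending on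
    [x], which is why [D] is assumed to scale with every translation. The outer integral then
    undergoes the affine change of variable of slope [a]. *)
Lemma lebesgue_scaled_ublock k (a : R) (r : 'rV[R]_k) (D : 'M[R]_k) c :
  a != 0 -> (forall e, lebesgue_scaled D e) ->
  lebesgue_scaled (block_mx a%:M r 0 D : 'M[R]_(1 + k)) c.
Proof.
move=> a0 hD A mA; rewrite -[c](@hsubmxK _ 1 1 k).
set c0 := lsubmx _; set c1 := rsubmx _.
rewrite det_ublock det_scalar1 normrM EFinM.
have affE x t : afft (block_mx a%:M r 0 D : 'M[R]_(1 + k)) (row_mx c0 c1) (ctuple (x, t))
    = ctuple (a * x + c0 0 0, afft D (x *: r + c1) t).
  rewrite /afft rowt_ctuple mul_row_block add_row_mx mulmx0 addr0.
  rewrite mul_scalar_mx mul_scalar_mx.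
  rewrite -tupr_row_mx; congr (tupr (row_mx _ _)).
    by apply/rowP => i; rewrite !ord1 !mxE eqxx !mulr1n mulrC.
  by rewrite addrA [rowt t *m D + _]addrC.
rewrite lebesgue_tupleS -muleA -ge0_integralZl_EFin //; last first.
  by apply: measurable_fun_section; exact: measurable_afft_preimage.
under eq_integral => x _.
  rewrite (_ : [set t | _] =
     afft D (x *: r + c1) @^-1` [set t | A (ctuple (a * x + c0 0 0, t))]); last first.
    by apply/seteqP; split => t /=; rewrite affE.
  rewrite hD; last exact: measurable_section.
  over.
rewrite (@integral_affine a (c0 0 0) (fun x => lebt [set t | A (ctuple (x, t))])) //.
  by rewrite lebesgue_tupleS.
exact: measurable_fun_section.
Qed.

(** The tail is fixed and the first coordinate is translated by an amount depending on the tail, so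
    translation invariance on the line suffices after integrating that coordinate first. *)
Lemma lebesgue_scaled_lunipotent k (v : 'cV[R]_k) :
  lebesgue_scaled (block_mx 1%:M 0 v 1%:M : 'M[R]_(1 + k)) 0.
Proof.
move=> A mA; rewrite det_lblock !det1 mulr1 normr1 mul1e.
have affE x t : afft (block_mx 1%:M 0 v 1%:M : 'M[R]_(1 + k)) 0 (ctuple (x, t))
    = ctuple (1 * x + (rowt t *m v) 0 0, t).
  rewrite /afft rowt_ctuple mul_row_block addr0 !mulmx1 mulmx0 add0r.
  rewrite -[X in ctuple (_, X)](rowtK t) -tupr_row_mx; congr (tupr (row_mx _ _)).
  by apply/rowP => i; rewrite !ord1 !mxE eqxx !mulr1n mul1r.
rewrite !lebesgue_tuple_fubini //; last exact: measurable_afft_preimage.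
apply: eq_integral => t _.
rewrite [RHS](@lebesgue_measure_affine 1 ((rowt t *m v) 0 0)) ?oner_neq0 //.
  rewrite normr1 mul1e; congr lebesgue_measure.
  by apply/seteqP; split => x /=; rewrite affE.
have /measurable_preimage_ctuple/(measurable_ysection t) := mA.
by congr measurable; apply/seteqP; split => x; rewrite /ysection /= inE.
Qed.

(* One pivot step of Gaussian elimination; a zero pivot is repaired by adding a row. *)
Lemma lebesgue_scaled_unitmx k (U : 'M[R]_k) c : U \in unitmx -> lebesgue_scaled U c.
Proof.
elim: k => [|k IH] in U c *.
  move=> _ A mA; rewrite det_mx00 normr1 mul1e; congr lebesgue_tuple.
  by apply/seteqP; split => t /=; rewrite (tuple0 (afft _ _ _)) (tuple0 t).
have pivot (V : 'M[R]_(1 + k)) e : V \in unitmx -> V 0 0 != 0 -> lebesgue_scaled V e.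
  move=> uV V00; set a := V 0 0 in V00.
  pose v := dlsubmx V; pose r := ursubmx V.
  pose D := drsubmx V - a^-1 *: (v *m r).
  have VE : V = (block_mx 1%:M 0 (a^-1 *: v) 1%:M : 'M[R]_(1 + k))
      *m (block_mx a%:M r 0 D : 'M[R]_(1 + k)).
    rewrite mulmx_block !mul1mx !mul0mx !addr0.
    rewrite mul_mx_scalar scalerA mulfV // scale1r.
    rewrite -scalemxAl [_ *: _ + D]addrC subrK -[LHS]submxK; congr block_mx.
    by apply/rowP => i; rewrite !ord1 !mxE eqxx mulr1n; congr (V _ _); apply: val_inj.
  have uD : D \in unitmx.
    move: uV; rewrite [V in V \in _]VE unitmx_mul => /andP[_].
    by rewrite !unitmxE det_ublock unitrM => /andP[].
  rewrite [V in lebesgue_scaled V]VE; apply: lebesgue_scaledM.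
    exact: lebesgue_scaled_lunipotent.
  by apply: lebesgue_scaled_ublock => // e'; exact: IH.
have l0 : lshift k (0 : 'I_1) = 0 :> 'I_k.+1 by exact: val_inj.
move=> uU; have [|U00] := boolP ((U : 'M[R]_(1 + k)) 0 0 != 0); first exact: pivot.
(* If the first column vanished, the invertible [U] would send a unit column vector to zero. *)
have [i Ui] : exists i : 'I_k, (U : 'M[R]_(1 + k)) (rshift 1 i) 0 != 0.
  apply/existsP; apply: contraT; rewrite negb_exists => /forallP U0.
  suff U0' : U *m delta_mx 0 (0 : 'I_1) = 0 :> 'cV_(1 + k).
    have := mulKmx uU (delta_mx 0 (0 : 'I_1)); rewrite U0' mulmx0 => /matrixP/(_ 0 0).
    by rewrite !mxE !eqxx => /eqP; rewrite eq_sym oner_eq0.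
  rewrite -colE; apply/colP => j; rewrite !mxE.
  rewrite -[j](@splitK 1 k); case: (@splitP 1 k j) => l _ /=.
    rewrite ord1 l0.
    by apply/eqP; move: U00; rewrite negbK.
  by apply/eqP; move: (U0 l); rewrite negbK.
pose E s : 'M[R]_(1 + k) := block_mx 1%:M (s *: delta_mx 0 i) 0 1%:M.
have EE : E (-1) *m E 1 = 1%:M.
  rewrite /E mulmx_block !mul1mx !mul0mx !mulmx0 !mulmx1 !addr0 !add0r.
  by rewrite scale1r scaleN1r subrr -scalar_mx_block.
have -> : U = E (-1) *m (E 1 *m U) by rewrite mulmxA EE mul1mx.
apply: lebesgue_scaledM.
  apply: lebesgue_scaled_ublock; first exact: oner_neq0.
  by move=> e; apply: IH; exact: unitmx1.
apply: pivot.
  by rewrite unitmx_mul uU andbT; case/mulmx1_unit: EE.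
rewrite mxE (@big_split_ord _ _ _ 1 k) /= big_ord1.
rewrite l0.
move: U00; rewrite negbK => /eqP ->; rewrite mulr0 add0r (bigD1 i) //=.
rewrite big1 ?addr0; last first.
  move=> j ji; rewrite /E -l0.
  by rewrite block_mxEur !mxE (negbTE ji) andbF mulr0 mul0r.
rewrite /E -[X in block_mx _ _ _ _ X _]l0.
by rewrite block_mxEur !mxE !eqxx mul1r mul1r.
Qed.

Lemma lebesgue_tuple_affine k (U : 'M[R]_k) c (A : set (k.-tuple R)) :
  `|\det U| = 1 -> measurable A -> lebt (afft U c @^-1` A) = lebt A.
Proof.
move=> U1 mA; rewrite -[RHS](@lebesgue_scaled_unitmx _ U c) // ?U1 ?mul1e //.
by rewrite unitmxE unitfE -normr_eq0 U1 oner_neq0.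
Qed.

Lemma measurable_hyperplane k (a : 'I_k -> R) (b : R) :
  measurable [set t : k.-tuple R | \sum_j tnth t j * a j = b].
Proof.
have := @measurable_linear_form k a (- b) measurableT [set 0] (measurable_set1 _).
rewrite setTI; congr measurable; apply/seteqP; split => t /=.
  by move/eqP; rewrite subr_eq0 => /eqP.
by move=> ->; rewrite subrr.
Qed.

(** Slice along the first coordinate. If some later coefficient is non-zero, every slice is a
    hyperplane of lower dimension; otherwise all slices are empty except at the single point
    [b / a ord0]. *)
Lemma lebesgue_hyperplane0 k (a : 'I_k -> R) (b : R) (i : 'I_k) : a i != 0 ->
  lebt [set t : k.-tuple R | \sum_j tnth t j * a j = b] = 0%E.
Proof.
elim: k => [|k IH] in a b i *; first by case: i.
move=> ai; rewrite lebesgue_tupleS.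
have sumE x t : \sum_j tnth (ctuple (x, t)) j * a j =
    x * a ord0 + \sum_j tnth t j * a (lift ord0 j).
  rewrite big_ord_recl tnth0; congr (_ + _).
  by apply: eq_bigr => j _; rewrite tnthS.
have [/existsP[j aj]|/existsPn a0] := boolP [exists j, a (lift ord0 j) != 0].
  apply: integral0_eq => x _; rewrite -[RHS](IH (fun j => a (lift ord0 j)) (b - x * a ord0) j) //.
  congr lebesgue_tuple; apply/seteqP; split => t /=; rewrite sumE => /eqP.
    by rewrite addrC eq_sym -subr_eq eq_sym => /eqP.
  by move=> /eqP ->; rewrite addrC subrK.
have a00 : a ord0 != 0.
  case: (unliftP ord0 i) => [j|] ij; last by rewrite -ij.
  by move: (a0 j); rewrite negbK -ij (negbTE ai).
rewrite (@ae_eq_integral _ _ _ _ _ (cst 0%E)) ?integral0 //.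
- by apply: measurable_fun_section; exact: measurable_hyperplane.
- exists [set b / a ord0]; split; [exact: measurable_set1|exact: lebesgue_measure_set1|].
  move=> x /= h; apply: contrapT => xb; apply: h => _.
  rewrite [X in lebesgue_tuple X](_ : _ = set0) ?measure0 // -subset0 => t /=.
  rewrite sumE big1 ?addr0; last first.
    by move=> j _; move: (a0 j); rewrite negbK => /eqP ->; rewrite mulr0.
  by move=> xab; apply: xb; rewrite -xab mulfK.
Qed.

Definition open_cube k : set (k.-tuple R) := [set t | forall i, 0 < tnth t i < 1].

Lemma lebesgue_open_cube k : lebt (@open_cube k) = 1%E.
Proof.
elim: k => [|k IH].
  by rewrite /= diracE mem_set // => -[].
have mI : measurable (`]0, 1[%classic : set (measurableTypeR R)) by [].
rewrite lebesgue_tupleS (eq_integral (fun x : measurableTypeR R =>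
  (\1_(`]0, 1[%classic : set (measurableTypeR R)) x)%:E)).
  by rewrite integral_indic // setIT [LHS]lebesgue_measure_itv /= lte_fin ltr01 sube0.
move=> x _; rewrite indicE.
have [xI|xI] := boolP (x \in `]0, 1[%classic).
  rewrite -[RHS]IH; congr lebesgue_tuple; apply/seteqP; split => t /=.
    by move=> h i; have := h (lift ord0 i); rewrite tnthS.
  move=> h i; case: (unliftP ord0 i) => [j ->|->]; first by rewrite tnthS.
  by rewrite tnth0; move: xI; rewrite inE /= in_itv.
rewrite [X in lebesgue_tuple X](_ : _ = set0) ?measure0 // -subset0 => t /= h.
by move: xI; rewrite notin_setE /= in_itv /=; apply; have := h ord0; rewrite tnth0.
Qed.

End LebesgueTuple.

(** * Order simplices *)

Section Cells.
Variable R : realType.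
Local Notation lebt := (@lebesgue_tuple R).

Section FinitePartition.
Context (dT : measure_display) (T : measurableType dT) (mu : {measure set T -> \bar R}).

Lemma measurable_forall (J : finType) (P : J -> set T) :
  (forall j, measurable (P j)) -> measurable [set t | forall j, P j t].
Proof.
move=> mP; have := @fin_bigcap_measurable _ T J [set: J] P finite_finset (fun j _ => mP j).
by congr measurable; apply/seteqP; split => t /= h j; [exact: h | move=> _; exact: h].
Qed.

Lemma measurable_lt_fun (f g : T -> R) : measurable_fun setT f ->
  measurable_fun setT g -> measurable [set t | f t < g t].
Proof.
move=> mf mg; have := measurable_fun_ltr mf mg measurableT (Y := [set true]).
by rewrite setTI; apply.
Qed.

Lemma measurable_le_fun (f g : T -> R) : measurable_fun setT f ->
  measurable_fun setT g -> measurable [set t | f t <= g t].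
Proof.
move=> mf mg; have := measurable_fun_ler mf mg measurableT (Y := [set true]).
by rewrite setTI; apply.
Qed.

Lemma measurable_imply (b : bool) (P : set T) :
  measurable P -> measurable [set t | b -> P t].
Proof.
by case: b => mP; [rewrite (_ : [set _ | _] = P) // | rewrite (_ : [set _ | _] = setT) //];
  apply/seteqP; split => t //= h; exact: h.
Qed.

Lemma null_exists (J : finType) (H : J -> set T) :
  (forall j, measurable (H j)) -> (forall j, mu (H j) = 0%E) ->
  measurable [set t | exists j, H j t] /\ mu [set t | exists j, H j t] = 0%E.
Proof.
move=> mH H0.
have -> : [set t | exists j, H j t] = \big[setU/set0]_(j <- enum J) H j.
  rewrite -bigcup_seq; apply/seteqP; split => t /= [j]; last by exists j.
  by move=> Hj; exists j => //=; rewrite mem_enum.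
elim: (enum J) => [|j s [mS S0]]; first by rewrite !big_nil measure0.
by rewrite big_cons; split; [exact: measurableU|rewrite measureU0].
Qed.

(** The null set [N] absorbs the walls between the cells: the union of the cells lies in [A], and
    [A] lies in that union together with [N]. *)
Lemma measure_finite_partition (J : finType) (D : {set J}) (A N : set T) (C : J -> set T) :
  measurable A -> measurable N -> mu N = 0%E ->
  (forall j, measurable (C j)) -> (forall j, j \in D -> C j `<=` A) ->
  (forall i j t, i \in D -> j \in D -> C i t -> C j t -> i = j) ->
  (forall t, A t -> ~ N t -> exists2 j, j \in D & C j t) ->
  mu A = (\sum_(j in D) mu (C j))%E.
Proof.
move=> mA mN N0 mC CA Cdisj Ccov.
pose B := \bigcup_(j in [set` D]) C j.
have mB : measurable B by apply: fin_bigcup_measurable => //; exact: finite_finset.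
have -> : (\sum_(j in D) mu (C j) = mu B)%E.
  rewrite /B measure_fin_bigcup //; last first.
  - by move=> i j iD jD [t [Cit Cjt]]; exact: (Cdisj i j t).
  rewrite (fsbigE (enum D)) ?enum_uniq //.
  - rewrite big_enum_cond /=; apply: eq_bigl => j.
    by rewrite mem_setE; case: (j \in D).
  - by move=> j /=; rewrite mem_enum.
  - by move=> j /= jD; rewrite mem_enum jD.
apply/eqP; rewrite eq_le; apply/andP; split.
  rewrite -[leRHS](measureU0 mB mN N0); apply: le_measure; rewrite ?inE //.
    exact: measurableU.
  move=> t At; have [Nt|Nt] := pselect (N t); [by right | left].
  by have [j jD Cj] := Ccov t At Nt; exists j.
by apply: le_measure; rewrite ?inE // => t [j /= jD]; exact: CA.
Qed.

(** The counting principle behind all volumes below: it is applied to the cube, to the hypersimplex,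
    to a corner and to the union of the pieces cut off. *)
Lemma measure_equipartition (J : finType) (D : {set J}) (c : R) (A N : set T) (C : J -> set T) :
  measurable A -> measurable N -> mu N = 0%E ->
  (forall j, measurable (C j)) -> (forall j, j \in D -> mu (C j) = c%:E) ->
  (forall j, j \in D -> C j `<=` A) ->
  (forall i j t, i \in D -> j \in D -> C i t -> C j t -> i = j) ->
  (forall t, A t -> ~ N t -> exists2 j, j \in D & C j t) ->
  mu A = (c *+ #|D|)%:E.
Proof.
move=> mA mN N0 mC cC CA Cdisj Ccov.
rewrite (@measure_finite_partition _ D A N C) // (eq_bigr _ cC) sumEFin.
by rewrite sumr_const.
Qed.

End FinitePartition.

Lemma measurable_tnth_real n (i : 'I_n) :
  measurable_fun setT (fun t : n.-tuple R => tnth t i : R).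
Proof. exact: measurable_tnth. Qed.

(** The value [w i] is the rank of the i-th coordinate, so [w] read as a word is the order pattern
    of [t], and its descents are the places where consecutive coordinates decrease. *)
Definition order_cell n (w : 'S_n) : set (n.-tuple R) :=
  [set t | open_cube t /\ forall i j : 'I_n, (w i < w j)%N -> tnth t i < tnth t j].

Lemma measurable_open_cube n : measurable (@open_cube R n).
Proof.
apply: measurable_forall => i.
rewrite (_ : (fun t => _) = [set t | 0 < tnth t i] `&` [set t | tnth t i < 1]).
  apply: measurableI; apply: measurable_lt_fun => //; exact: measurable_tnth_real.
by apply/seteqP; split => t /= /andP.
Qed.

Lemma measurable_order_cell n (w : 'S_n) : measurable (order_cell w).
Proof.
rewrite (_ : order_cell w = @open_cube R n `&`
  [set t | forall i j : 'I_n, (w i < w j)%N -> tnth t i < tnth t j]) //.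
apply: measurableI; first exact: measurable_open_cube.
apply: measurable_forall => i; apply: measurable_forall => j.
by apply: measurable_imply; apply: measurable_lt_fun; exact: measurable_tnth_real.
Qed.

Lemma order_cell_lt n (w : 'S_n) t i j : order_cell w t ->
  (tnth t i < tnth t j) = (w i < w j)%N.
Proof.
move=> [_ h]; have [wij|wji|wij] := ltngtP (w i) (w j); first exact: h.
  by apply/negbTE; rewrite -leNgt ltW // h.
by rewrite (perm_inj (val_inj wij)) ltxx.
Qed.

Lemma card_ord_lt n m : (m <= n)%N -> #|[set k : 'I_n | (k < m)%N]%SET| = m.
Proof.
move=> mn; rewrite -sum1dep_card (big_ord_narrow mn) /=.
by rewrite sum_nat_const card_ord muln1.
Qed.

(** Recovers a permutation from its comparisons alone; this gives the disjointness of the order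
    cells. *)
Lemma perm_rank n (w : 'S_n) i : #|[set j | (w j < w i)%N]%SET| = w i.
Proof.
rewrite -[RHS](@card_ord_lt n) 1?ltnW // -[LHS](card_imset _ (@perm_inj _ w)).
apply: eq_card => k; rewrite !inE; apply/imsetP/idP => [[j]|kw].
  by rewrite inE => jw ->.
by exists (w^-1%g k); rewrite ?inE permKV.
Qed.

Lemma order_cell_inj n (w w' : 'S_n) t : order_cell w t -> order_cell w' t -> w = w'.
Proof.
move=> wt w't; apply/permP => i; apply: val_inj.
rewrite /= -perm_rank -[RHS]perm_rank; apply: eq_card => j; rewrite !inE.
by rewrite -(order_cell_lt _ _ wt) -(order_cell_lt _ _ w't).
Qed.

(** Let [w i] count the keys below [key i]; distinct keys have distinct counts. *)
Lemma perm_of_key n (dT : Order.disp_t) (T : orderType dT) (key : 'I_n -> T) :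
  injective key -> exists w : 'S_n, forall i j, (w i < w j)%N = (key i < key j)%O.
Proof.
move=> key_inj; pose r i := #|[set j | (key j < key i)%O]%SET|.
have rn i : (r i < n)%N.
  rewrite -[X in (_ < X)%N](card_ord n) -cardsT; apply: proper_card.
  by apply/properP; split; [exact: finset.subsetT | exists i; rewrite ?inE ?ltxx].
have rlt i j : (key i < key j)%O -> (r i < r j)%N.
  move=> kij; apply: proper_card; apply/properP; split.
    by apply/fintype.subsetP => l; rewrite !inE => /lt_trans; exact.
  by exists i; rewrite inE ?ltxx.
pose f i := Ordinal (rn i).
have finj : injective f.
  move=> i j [] rij; apply: key_inj; apply/eqP; apply: contraT.
  by rewrite neq_lt => /orP[] /rlt; rewrite rij ltnn.
exists (perm finj) => i j; rewrite !permE /=.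
have [kij|kji|/key_inj ->] := ltgtP (key i) (key j); first exact: rlt.
  by apply/negbTE; rewrite -leqNgt ltnW // rlt.
by rewrite ltnn.
Qed.

(** Serves to relabel the ground set so that a given circuit-hyperplane becomes an initial segment
    of the coordinates. *)
Lemma perm_onto_prefix m (S : {set 'I_m}) :
  exists w : 'S_m, forall k, (w k < #|S|)%N = (k \in S).
Proof.
(* Elements outside [S] receive keys at least [m], hence are ranked after all of [S]. *)
pose key (k : 'I_m) : nat := if k \in S then k : nat else (m + k)%N.
have key_inj : injective key.
  move=> k l; rewrite /key; have := ltn_ord k; have := ltn_ord l.
  by case: (k \in S); case: (l \in S) => ? ? kl; apply: val_inj => //=; lia.
have [w wkey] := perm_of_key key_inj; exists w => k.
have -> : w k = #|[set l | (key l < key k)%N]%SET| :> nat.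
  by rewrite -(perm_rank w); apply: eq_card => l; rewrite !inE wkey ltEnat.
apply/idP/idP => [|kS].
  apply: contraTT => kS; rewrite -leqNgt; apply: subset_leq_card.
  apply/fintype.subsetP => l lS; rewrite inE /key lS (negbTE kS).
  by have := ltn_ord l; lia.
apply: proper_card; apply/properP; split; last by exists k; rewrite ?inE ?ltnn.
apply/fintype.subsetP => l; rewrite inE /key kS; case: ifP => // _.
by have := ltn_ord k; lia.
Qed.

Lemma order_cell_exists n (t : n.-tuple R) : open_cube t ->
  (forall i j : 'I_n, i != j -> tnth t i != tnth t j) -> exists w, order_cell w t.
Proof.
move=> ct dt; have [|w wt] := @perm_of_key n _ R (tnth t).
  by move=> i j tij; apply/eqP; apply: contraT => /dt; rewrite tij eqxx.
by exists w; split => // i j; rewrite wt.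
Qed.

(** A permutation of the coordinates has determinant 1 or -1 and matches the two cells. *)
Lemma lebesgue_order_cell_perm n (w : 'S_n) : lebt (order_cell w) = lebt (order_cell (1%g : 'S_n)).
Proof.
rewrite -(@lebesgue_tuple_affine R n (perm_mx w) 0 (order_cell (1%g : 'S_n))).
- congr lebesgue_tuple; rewrite /preimage.
  have affE (t : n.-tuple R) j : tnth (afft (perm_mx w) 0 t) j = tnth t ((w^-1)%g j).
    rewrite tnth_afft mxE addr0 (bigD1 ((w^-1)%g j)) //= !mxE permKV eqxx mulr1.
    rewrite big1 ?addr0 // => i ij; rewrite !mxE.
    case: eqP => [wij|_]; last by rewrite mulr0.
    by move: ij; rewrite -wij permK eqxx.
  apply/seteqP; split => t /= [ct ht]; split.
  + by move=> i; rewrite affE.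
  + by move=> i j; rewrite !perm1 !affE => ij; apply: ht; rewrite !permKV.
  + by move=> i; have := ct (w i); rewrite affE permK.
  + by move=> i j ij; have := ht (w i) (w j); rewrite !perm1 !affE !permK; apply.
- by rewrite det_perm normrX normrN1 expr1n.
- exact: measurable_order_cell.
Qed.

(* The diagonal pairs [(i, i)] contribute the hyperplane [t_i = 0]. *)
Definition coincident n : set (n.-tuple R) :=
  [set t | exists p : 'I_n * 'I_n,
    \sum_l tnth t l * ((l == p.1)%:R - ((l == p.2) && (p.1 != p.2))%:R) = 0].

Lemma coincident_null n : measurable (@coincident n) /\ lebt (@coincident n) = 0%E.
Proof.
apply: null_exists => -[i j]; first exact: measurable_hyperplane.
apply: (@lebesgue_hyperplane0 _ _ _ _ i) => /=.
by rewrite eqxx; case: (i == j); rewrite subr0 oner_neq0.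
Qed.

Lemma sum_tnth_delta n (t : n.-tuple R) i : \sum_l tnth t l * (l == i)%:R = tnth t i.
Proof.
rewrite (bigD1 i) //= eqxx mulr1 big1 ?addr0 // => j /negbTE ->.
by rewrite mulr0.
Qed.

Lemma not_coincident n (t : n.-tuple R) : ~ coincident t ->
  (forall i, tnth t i != 0) /\ (forall i j, i != j -> tnth t i != tnth t j).
Proof.
move=> ct; split=> [i|i j ij]; apply/eqP => h; apply: ct.
  exists (i, i) => /=; rewrite -[RHS]h -[RHS]sum_tnth_delta.
  by apply: eq_bigr => l _; rewrite eqxx andbF subr0.
exists (i, j) => /=; rewrite ij.
under eq_bigr do rewrite andbT mulrBr.
by rewrite sumrB !sum_tnth_delta h subrr.
Qed.

Lemma lebesgue_order_cell n (w : 'S_n) : lebt (order_cell w) = ((n`!)%:R^-1)%:E.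
Proof.
rewrite lebesgue_order_cell_perm.
have [mN N0] := coincident_null n.
(* Finiteness turns the common measure of the cells into a real number, which can then be divided
   out. *)
have cell_fin : lebt (order_cell (1%g : 'S_n)) \is a fin_num.
  rewrite ge0_fin_numE //; apply: (@le_lt_trans _ _ 1%E); last exact: ltry.
  rewrite -(lebesgue_open_cube R n); apply: le_measure; rewrite ?inE.
  - exact: measurable_order_cell.
  - exact: measurable_open_cube.
  - by move=> t [].
have : lebt (@open_cube R n) =
    (fine (lebt (order_cell (1%g : 'S_n))) *+ #|[set: 'S_n]%SET|)%:E.
  apply: (@measure_equipartition _ _ (@lebesgue_tuple R n) _ _ _ _ _ (@order_cell n)
    (@measurable_open_cube n) mN N0 (@measurable_order_cell n)).
  - by move=> v _; rewrite fineK //; exact: lebesgue_order_cell_perm.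
  - by move=> v _ t [].
  - by move=> v v' t _ _; exact: order_cell_inj.
  - move=> t ct /not_coincident[_ dt].
    by have [v vt] := order_cell_exists ct dt; exists v; rewrite ?inE.
rewrite lebesgue_open_cube cardsT card_Sn => -[h].
rewrite -(fineK cell_fin); congr EFin.
have n0 : (n`!)%:R != 0 :> R by rewrite pnatr_eq0 -lt0n fact_gt0.
by apply: (mulfI n0); rewrite mulfV // mulr_natl -h.
Qed.

End Cells.

(** * The hypersimplex *)

Section Slab.
Variables (R : realType) (n : nat).
Local Notation lebt := (@lebesgue_tuple R).
Implicit Types (w : 'S_n) (t : n.-tuple R) (i j : 'I_n).

(** On the cell of [w] in the slab this number is the integral part of the partial sum up to
    coordinate [i]. *)
Definition descents_before w (i : nat) : nat := #|[set l in descents w | (l < i)%N]%SET|.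

Lemma descents_before0 w : descents_before w 0 = 0%N.
Proof. by apply/eqP; rewrite cards_eq0; apply/eqP/setP => l; rewrite !inE andbF. Qed.

Lemma descentsP w i j : j = i.+1 :> nat -> (i \in descents w) = (w j < w i)%N.
Proof.
move=> ji; rewrite inE; apply/existsP/idP => [[l /andP[/eqP li]]|wji].
  by rewrite (_ : l = j) //; apply: val_inj; rewrite /= li ji.
by exists j; rewrite ji eqxx.
Qed.

Lemma descents_beforeS w i j : j = i.+1 :> nat ->
  descents_before w j = (descents_before w i + (w j < w i)%N)%N.
Proof.
move=> ji; rewrite -(descentsP w ji) /descents_before addnC.
rewrite (cardsD1 i) !inE ji ltnSn andbT; congr (_ + _)%N.
apply: eq_card => l; rewrite !inE ltnS -(inj_eq val_inj) /=.
by case: (ltngtP l i) => _; rewrite ?andbF ?andbT //=.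
Qed.

Lemma descents_before_last w i : i = n.-1 :> nat -> descents_before w i = #|descents w|.
Proof.
move=> i_last; apply: eq_card => l; rewrite inE; case: (boolP (l \in descents w)) => //=.
rewrite inE => /existsP[j /andP[/eqP jl _]].
by apply/idP; have := ltn_ord j; rewrite jl i_last; lia.
Qed.

(** The partial sum includes the coordinate [i] itself. It is written as a linear form in all
    coordinates, to match matrix entries and hyperplanes. *)
Definition psum t (i : nat) : R := \sum_l tnth t l * (l <= i)%N%:R.

Lemma psum0 t i : i = 0%N :> nat -> psum t i = tnth t i.
Proof.
move=> i0; rewrite -sum_tnth_delta; apply: eq_bigr => l _; congr (_ * _%:R).
by rewrite i0 leqn0 -[l == i](inj_eq val_inj) /= i0.
Qed.

Lemma psumS t i j : j = i.+1 :> nat -> psum t j = psum t i + tnth t j.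
Proof.
move=> ji; rewrite -[in RHS]sum_tnth_delta -big_split /=; apply: eq_bigr => l _.
rewrite -mulrDr -natrD; congr (_ * _%:R).
by rewrite leq_eqVlt -[l == j](inj_eq val_inj) /= ji ltnS; case: ltngtP => //; lia.
Qed.

Lemma psum_last t i : i = n.-1 :> nat -> psum t i = \sum_l tnth t l.
Proof.
move=> il; apply: eq_bigr => l _; rewrite il (_ : (l <= n.-1)%N) ?mulr1 //.
by have := ltn_ord l; lia.
Qed.

Lemma ord_case i : i = 0%N :> nat \/ exists j, i = j.+1 :> nat.
Proof.
case: i => -[|i] hi; first by left.
by right; exists (Ordinal (ltnW hi)).
Qed.

Definition prefix_mx : 'M[R]_n := \matrix_(l, i) (l <= i)%N%:R.

Definition descent_shift w : 'rV[R]_n := \row_i - (descents_before w i)%:R.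

Lemma tnth_prefix w t i :
  tnth (afft prefix_mx (descent_shift w) t) i = psum t i - (descents_before w i)%:R.
Proof.
rewrite tnth_afft mxE; congr (_ + _).
by apply: eq_bigr => l _; rewrite mxE.
Qed.

Lemma det_prefix_mx : \det prefix_mx = 1.
Proof.
rewrite -det_tr det_trig; last first.
  by apply/is_trig_mxP => i j ij; rewrite !mxE leqNgt ij.
by rewrite big1 // => i _; rewrite !mxE leqnn.
Qed.

(** Stanley's map takes fractional parts of partial sums. Where the integral parts are the descent
    counts of [w] it is the affine map used here, and the cell consists of the points whose
    fractional parts have order pattern [w]. *)
Definition slab_cell w : set (n.-tuple R) :=
  afft prefix_mx (descent_shift w) @^-1` order_cell w.

Lemma slab_cellP w t : slab_cell w t ->
  (forall i, 0 < psum t i - (descents_before w i)%:R < 1) /\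
  (forall i j, (w i < w j)%N ->
    psum t i - (descents_before w i)%:R < psum t j - (descents_before w j)%:R).
Proof.
move=> [h1 h2]; split=> [i|i j ij]; first by have := h1 i; rewrite tnth_prefix.
by have := h2 i j ij; rewrite !tnth_prefix.
Qed.

Definition slab (d : nat) : set (n.-tuple R) :=
  [set t | (forall i, 0 <= tnth t i <= 1) /\ d%:R <= \sum_l tnth t l <= d.+1%:R].

(** With u the fractional parts, each coordinate after the first is the increment of u, plus one
    exactly at a descent of [w]; as u lies in the open unit interval, this stays between 0 and 1.
    The total is the last fractional part plus the number of descents. *)
Lemma slab_cell_sub w : (0 < n)%N -> slab_cell w `<=` slab #|descents w|.
Proof.
move=> n0 t /slab_cellP[u01 ult]; split=> [i|].
  case: (ord_case i) => [i0|[j ij]].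
    by have := u01 i; rewrite i0 descents_before0 subr0 -i0 psum0 // => /andP[/ltW -> /ltW ->].
  have := u01 i; have := u01 j; have := ult i j; have := ult j i.
  rewrite (psumS t ij) (descents_beforeS w ij) natrD.
  have [wij|wji|wij] := ltngtP (w i) (w j).
  - by move=> _ /(_ isT); rewrite (_ : true%:R = 1 :> R) //; lra.
  - by move=> /(_ isT) + _; rewrite (_ : false%:R = 0 :> R) //; lra.
  - by have := perm_inj (val_inj wij) => eij; move: ij; rewrite eij; lia.
have ln : (n.-1 < n)%N by rewrite prednK.
have := u01 (Ordinal ln); rewrite psum_last // descents_before_last //.
by rewrite -natr1; lra.
Qed.

(** The integral parts of the partial sums of [t] fix all descent counts, so the two affine maps
    coincide and disjointness of order cells applies. *)
Lemma slab_cell_inj w w' t : slab_cell w t -> slab_cell w' t -> w = w'.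
Proof.
move=> wt w't; have [u _] := slab_cellP wt; have [u' _] := slab_cellP w't.
have e i : descents_before w i = descents_before w' i.
  have := u i; have := u' i; set a := descents_before w i; set b := descents_before w' i.
  have [ab|ab|//] := ltngtP a b.
  - by have : a%:R + 1 <= b%:R :> R; [rewrite natr1 ler_nat | move=> *; exfalso; lra].
  - by have : b%:R + 1 <= a%:R :> R; [rewrite natr1 ler_nat | move=> *; exfalso; lra].
apply: (order_cell_inj wt); rewrite (_ : descent_shift w = descent_shift w') //.
by apply/rowP => i; rewrite !mxE e.
Qed.

(* The disjunct [l == j] only keeps the coefficients non-zero when the block is empty. *)
Definition integral_block : set (n.-tuple R) :=
  [set t | exists p : 'I_n.+1 * 'I_n * 'I_n.+1,
    \sum_l tnth t l * ((l == p.1.2) || (p.1.1 <= l <= p.1.2)%N)%:R = p.2%:R].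

Lemma integral_block_null : measurable integral_block /\ lebt integral_block = 0%E.
Proof.
apply: null_exists => -[[i j] k]; first exact: measurable_hyperplane.
by apply: (@lebesgue_hyperplane0 _ _ _ _ j) => /=; rewrite eqxx oner_neq0.
Qed.

Lemma not_integral_block t : ~ integral_block t ->
  (forall i (k : nat), (k <= n)%N -> psum t i != k%:R) /\
  (forall i j (k : nat), (i < j)%N -> (k <= n)%N -> psum t j - psum t i != k%:R).
Proof.
move=> gt; split=> [i k kn|i j k ij kn]; apply/eqP => h; apply: gt.
  have kn1 : (k < n.+1)%N by [].
  exists (ord0, i, Ordinal kn1) => /=; rewrite -h; apply: eq_bigr => l _.
  by congr (_ * _%:R); case: eqP => // ->; rewrite leqnn.
have kn1 : (k < n.+1)%N by [].
have in1 : (i.+1 < n.+1)%N by have := ltn_ord i.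
exists (Ordinal in1, j, Ordinal kn1) => /=; rewrite -h -sumrB; apply: eq_bigr => l _.
rewrite -mulrBr; congr (_ * _).
have -> : (l == j) || (i < l <= j)%N = (i < l <= j)%N.
  by case: eqP => // ->; rewrite ij leqnn.
case: (leqP l i) => li /=; last by rewrite subr0.
by rewrite (leq_trans li (ltnW ij)) subrr.
Qed.

(** Take for [w] the order pattern of the fractional parts, which are positive and distinct off the
    null set. Each coordinate lies strictly between 0 and 1 after the first, so the integral part
    grows by one exactly when the fractional part drops, that is, at a descent. *)
Lemma slab_cell_cover d t : (0 < n)%N -> slab d t -> ~ integral_block t ->
  exists2 w, w \in [set w : 'S_n | #|descents w| == d]%SET & slab_cell w t.
Proof.
move=> n0 [t01 td] /not_integral_block[gen1 gen2].
have ps_ge0 i : 0 <= psum t i.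
  by apply: sumr_ge0 => l _; rewrite mulr_ge0 ?ler0n //; case/andP: (t01 l).
have ps_mono i j : (i <= j)%N -> psum t i <= psum t j.
  move=> ij; apply: ler_sum => l _; apply: ler_wpM2l; first by case/andP: (t01 l).
  by rewrite ler_nat; case: (leqP l i) => // li; rewrite (leq_trans li ij).
have ps_len i : psum t i <= n%:R.
  rewrite -[n in leRHS]card_ord -sum1_card natr_sum; apply: ler_sum => l _.
  have /andP[? ?] := t01 l; rewrite -[leRHS]mulr1; apply: ler_pM => //.
  by case: (_ <= _)%N; rewrite ?ler01.
pose k i := Num.truncn (psum t i).
have kn i : (k i <= n)%N.
  rewrite -(ler_nat R); apply: le_trans (ps_len i).
  by have /andP[] := truncn_itv (ps_ge0 i).
have kps i : (k i)%:R < psum t i < (k i).+1%:R.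
  have /andP[h1 h2] := truncn_itv (ps_ge0 i).
  by rewrite h2 andbT lt_neqAle h1 andbT eq_sym gen1.
pose u : n.-tuple R := [tuple psum t i - (k i)%:R | i < n].
have uE i : tnth u i = psum t i - (k i)%:R by rewrite tnth_mktuple.
have u_cube : open_cube u.
  by move=> i; rewrite uE; have := kps i; rewrite -natr1; lra.
have k_mono i j : (i <= j)%N -> (k i <= k j)%N.
  move=> /ps_mono ij; have := kps i; have := kps j.
  by rewrite -[(k i <= k j)%N]ltnS -(ltr_nat R); lra.
have u_distinct i j : i != j -> tnth u i != tnth u j.
  wlog ij : i j / (i < j)%N => [hw|_].
    rewrite -(inj_eq val_inj) /= neq_ltn => /orP[] ij.
      by apply: hw; rewrite // -(inj_eq val_inj) /= neq_ltn ij.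
    by rewrite eq_sym; apply: hw; rewrite // -(inj_eq val_inj) /= neq_ltn ij.
  apply/eqP; rewrite !uE => h.
  have /eqP := gen2 i j (k j - k i)%N ij (leq_trans (leq_subr _ _) (kn j)); apply.
  by rewrite natrB ?k_mono 1?ltnW //; lra.
have [w wu] := order_cell_exists u_cube u_distinct.
have kE : forall m i, i = m :> nat -> k i = descents_before w i.
  elim=> [|m IH] i im.
    rewrite im descents_before0; apply/eqP; rewrite -leqn0 -ltnS -(ltr_nat R).
    have := kps i; rewrite psum0 //; have := t01 i.
    by move=> /andP[_ ti] /andP[h _]; exact: lt_le_trans h ti.
  have mn : (m < n)%N by have := ltn_ord i; rewrite im; lia.
  pose j := Ordinal mn; have ij : i = j.+1 :> nat by [].
  rewrite (descents_beforeS w ij) -(IH j erefl) -(order_cell_lt _ _ wu) !uE.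
  have := kps i; have := kps j; have := t01 i; rewrite (psumS t ij) -!natr1.
  have ti1 : psum t i - psum t j != 1 by rewrite (gen2 _ _ 1%N) // ij.
  have ti0 : psum t i - psum t j != 0 by rewrite (gen2 _ _ 0%N) // ij.
  rewrite (psumS t ij) addrC addKr in ti1 ti0.
  move=> /andP[ti_ge ti_le] kj ki.
  have {ti_ge ti0}ti_gt : 0 < tnth t i by rewrite lt_neqAle eq_sym ti0.
  have {ti_le ti1}ti_lt : tnth t i < 1 by rewrite lt_neqAle ti1.
  (* Natural numbers less than one apart are equal; both the descent and the ascent case are closed
     in this way. *)
  have step (a b : nat) : a%:R < b%:R + 1 :> R -> b%:R < a%:R + 1 :> R -> a = b.
    rewrite !natr1 !ltr_nat !ltnS => ab ba; apply/eqP; by rewrite eqn_leq ab ba.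
  case: ltP => h; apply: step; rewrite natrD.
  1,2: by rewrite (_ : true%:R = 1 :> R) //; lra.
  1,2: by rewrite (_ : false%:R = 0 :> R) //; lra.
exists w; last first.
  rewrite /slab_cell /preimage /= (_ : afft _ _ t = u) //.
  by apply: eq_from_tnth => i; rewrite tnth_prefix uE (kE i i erefl).
have ln : (n.-1 < n)%N by rewrite prednK.
rewrite inE -(@descents_before_last w (Ordinal ln)) // -(kE _ (Ordinal ln) erefl).
(* The total is strictly between its integral part and the next integer, and lies in [d, d + 1];
   this forces the integral part to be [d]. *)
have := kps (Ordinal ln); rewrite psum_last //.
move=> /andP[h1 h2]; move/andP: td => [h3 h4].
have := le_lt_trans h3 h2; have := lt_le_trans h1 h4.
by rewrite !ltr_nat !ltnS => ? ?; rewrite eqn_leq; apply/andP.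
Qed.

Lemma measurable_slab d : measurable (slab d).
Proof.
rewrite (_ : slab d = [set t | forall i, (0 <= tnth t i) && (tnth t i <= 1)] `&`
  ([set t | d%:R <= \sum_l tnth t l] `&` [set t | \sum_l tnth t l <= d.+1%:R])); last first.
  by apply/seteqP; split => t [h1] => [/andP[]|[h2 h3]]; split => //; apply/andP.
have mS : measurable_fun setT (fun t : n.-tuple R => \sum_l tnth t l).
  by apply: measurable_sum => l; exact: measurable_tnth_real.
apply: measurableI; last by apply: measurableI; exact: measurable_le_fun.
apply: measurable_forall => i.
rewrite (_ : (fun t => _) = [set t | 0 <= tnth t i] `&` [set t | tnth t i <= 1]).
  by apply: measurableI; apply: measurable_le_fun => //; exact: measurable_tnth_real.
by apply/seteqP; split => t /= /andP.
Qed.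

Lemma lebesgue_slab d : (0 < n)%N ->
  lebt (slab d) = ((n`!)%:R^-1 * (eulerian n d)%:R)%:E.
Proof.
move=> n0; rewrite mulr_natr /eulerian.
have [mN N0] := integral_block_null.
have mC w : measurable (slab_cell w).
  by apply: measurable_afft_preimage; exact: measurable_order_cell.
apply: (@measure_equipartition _ _ _ (@lebesgue_tuple R n) _ _ _ _ _ slab_cell
  (measurable_slab d) mN N0 mC).
- move=> w _; rewrite -(lebesgue_order_cell R w).
  apply: lebesgue_tuple_affine; last exact: measurable_order_cell.
  by rewrite det_prefix_mx normr1.
- by move=> w; rewrite inE => /eqP <-; exact: slab_cell_sub.
- by move=> w w' t _ _; exact: slab_cell_inj.
- by move=> t; exact: slab_cell_cover.
Qed.

End Slab.

(** * The corners *)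

Section Corner.
Variables (R : realType) (n : nat) (d : 'I_n).
Local Notation lebt := (@lebesgue_tuple R).
Implicit Types (w : 'S_n) (t : n.-tuple R) (i j : 'I_n).

(** The first [d.+1] coordinates play the role of a circuit-hyperplane: this is the piece on which
    their sum exceeds [d]. *)
Definition corner : set (n.-tuple R) := [set t | slab d t /\ d%:R < psum t d].

Definition corner_perms : {set 'S_n} :=
  [set w : 'S_n |
    [forall i : 'I_n, forall j : 'I_n,
      ((i < j) && ((j <= d) || (d < i)))%N ==> (w i < w j)%N]
            && [forall i : 'I_n, (i != d) ==> (w i < w d)%N]]%SET.

Lemma corner_permsP w : reflect
  [/\ forall i j, (i < j <= d)%N -> (w i < w j)%N,
      forall i j, (d < i < j)%N -> (w i < w j)%N
    & forall i, i != d -> (w i < w d)%N]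
  (w \in corner_perms).
Proof.
rewrite inE; apply: (iffP andP) => [[/forallP h /forallP h']|[h1 h2 h3]].
  split=> [i j /andP[ij jd]|i j /andP[di ij]|i id].
  - by have /forallP/(_ j)/implyP := h i; apply; rewrite ij jd.
  - by have /forallP/(_ j)/implyP := h i; apply; rewrite ij di orbT.
  - by have /implyP := h' i; exact.
split; apply/forallP => i; last by apply/implyP; exact: h3.
apply/forallP => j; apply/implyP => /andP[ij /orP[jd|di]].
  by apply: h1; rewrite ij jd.
by apply: h2; rewrite di ij.
Qed.

(** Together with the shift below, this produces the partial sums of 1 - t_l on the block up to [d]
    and the partial sums of t_l on the block after it. The matrix is triangular with diagonal
    entries -1 and 1. *)
Definition corner_mx : 'M[R]_n := \matrix_(l, i)
  (if (i <= d)%N then - (l <= i)%N%:R else (l <= i)%N%:R - (l <= d)%N%:R).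
Definition corner_shift : 'rV[R]_n := \row_i (if (i <= d)%N then i.+1%:R else 0).

Lemma tnth_corner_lo t i : (i <= d)%N ->
  tnth (afft corner_mx corner_shift t) i = i.+1%:R - psum t i.
Proof.
move=> id; rewrite tnth_afft mxE id addrC; congr (_ + _).
by rewrite /psum -sumrN; apply: eq_bigr => l _; rewrite mxE id mulrN.
Qed.

Lemma tnth_corner_hi t i : (d < i)%N ->
  tnth (afft corner_mx corner_shift t) i = psum t i - psum t d.
Proof.
move=> di; rewrite tnth_afft mxE leqNgt di /= addr0 /psum -sumrB.
by apply: eq_bigr => l _; rewrite mxE leqNgt di /= mulrBr.
Qed.

Lemma det_corner_mx : `|\det corner_mx| = 1.
Proof.
rewrite -det_tr det_trig; last first.
  apply/is_trig_mxP => i j ij; rewrite !mxE [(j <= i)%N]leqNgt ij /= oppr0 sub0r.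
  by case: ifP => // /negbT; rewrite -ltnNge => di; rewrite leqNgt (ltn_trans di ij) oppr0.
rewrite normr_prod big1 // => i _; rewrite !mxE leqnn.
by case: (i <= d)%N; rewrite ?normrN1 ?subr0 ?normr1.
Qed.

Definition corner_cell w : set (n.-tuple R) :=
  afft corner_mx corner_shift @^-1` order_cell w.

(** Write u for the image of [t]. Monotonicity of [w] on the two blocks makes the increments 1 - t_i
    and t_i of u non-negative. The value of u at [d] is d + 1 minus the first block sum, so being
    below 1 it gives the corner inequality, and being maximal it bounds the total by d + 1. *)
Lemma corner_cell_sub w : w \in corner_perms -> corner_cell w `<=` corner.
Proof.
move=> /corner_permsP[W1 W2 W3] t [u01 ult].
set u := afft _ _ _ in u01 ult.
have ud : tnth u d = d.+1%:R - psum t d by rewrite tnth_corner_lo.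
have ud01 := u01 d; rewrite ud -natr1 in ud01.
have psd : d%:R < psum t d by lra.
split=> //; split=> [i|].
  have [id|di] := leqP i d.
    case: (ord_case i) => [i0|[j ij]].
      by have := u01 i; rewrite tnth_corner_lo // psum0 // i0 -natr1; lra.
    have jd : (j < d)%N by rewrite -ij.
    have wji : (w j < w i)%N by rewrite W1 // ij ltnSn -ij.
    have := ult _ _ wji; have := u01 i; have := u01 j.
    rewrite !tnth_corner_lo // 1?ltnW // (psumS t ij) ij -!natr1; lra.
  case: (ord_case i) => [i0|[j ij]]; first by move: di; rewrite i0.
  have [dj|jd] := ltnP d j.
    have wji : (w j < w i)%N by rewrite W2 // ij dj ltnSn.
    have := ult _ _ wji; have := u01 i; have := u01 j.
    by rewrite !tnth_corner_hi // (psumS t ij); lra.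
  (* At the first index of the second block the partial sums restart, so the image coordinate is
     [tnth t i] itself. *)
  have jdE : j = d by apply: val_inj; apply/eqP; rewrite /= eqn_leq jd -ltnS -ij di.
  have := u01 i; rewrite tnth_corner_hi // (psumS t ij) jdE; lra.
have ln : (n.-1 < n)%N by have := ltn_ord d; lia.
rewrite -(@psum_last _ _ t (Ordinal ln)) //.
have [dl|ld] := ltnP d (Ordinal ln).
  have wld : (w (Ordinal ln) < w d)%N.
    by apply: W3; rewrite -(inj_eq val_inj) /= neq_ltn dl orbT.
  have := ult _ _ wld; have := u01 (Ordinal ln); rewrite ud tnth_corner_hi // -natr1.
  lra.
have -> : Ordinal ln = d.
  by apply: val_inj; apply/eqP; rewrite eqn_leq ld /=; have := ltn_ord d; lia.
by rewrite -natr1; lra.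
Qed.

Lemma psum_bounds t i j : (forall l, 0 <= tnth t l <= 1) -> (i <= j)%N ->
  psum t i <= psum t j <= psum t i + (j%:R - i%:R).
Proof.
move=> t01 ij; have [m jm] : exists m, j = (i + m)%N :> nat.
  by exists (j - i)%N; rewrite subnKC.
elim: m => [|m IH] in j jm {ij} *.
  have -> : j = i by apply: val_inj; rewrite /= jm addn0.
  by rewrite subrr addr0 lexx.
have ln : (i + m < n)%N by have := ltn_ord j; rewrite jm; lia.
have jS : j = (Ordinal ln).+1 :> nat by rewrite jm addnS.
have := IH (Ordinal ln) erefl; have := t01 j; rewrite (psumS t jS) jS -natr1 /=; lra.
Qed.

(** The bounds on the coordinates make the image u non-negative and weakly increasing on each block,
    the bound d + 1 on the total makes its value at [d] maximal, and the corner inequality puts that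
    value below 1. Off the null set all these comparisons become strict. *)
Lemma corner_cell_cover t : corner t ->
  ~ (afft corner_mx corner_shift @^-1` @coincident R n) t ->
  exists2 w, w \in corner_perms & corner_cell w t.
Proof.
move=> [[t01 td] psd] /not_coincident[u_neq0 u_neq].
set u := afft _ _ _ in u_neq0 u_neq.
have n0 : (0 < n)%N by have := ltn_ord d; lia.
have ln : (n.-1 < n)%N by have := ltn_ord d; lia.
have ud : tnth u d = d.+1%:R - psum t d by rewrite tnth_corner_lo.
have u_lo i j : (i <= j <= d)%N -> tnth u i <= tnth u j.
  move=> /andP[ij jd]; rewrite !tnth_corner_lo // ?(leq_trans ij) //.
  by have := psum_bounds t01 ij; rewrite -!natr1; lra.
have u_hi i j : (d < i <= j)%N -> tnth u i <= tnth u j.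
  move=> /andP[di ij]; rewrite !tnth_corner_hi ?(leq_trans di) //.
  by have := psum_bounds t01 ij; lra.
have u_hid i : (d < i)%N -> tnth u i <= tnth u d.
  move=> di; rewrite ud tnth_corner_hi //.
  have il : (i <= Ordinal ln)%N by have := ltn_ord i => /=; lia.
  have := psum_bounds t01 il; rewrite (@psum_last _ _ t (Ordinal ln)) //; lra.
have u_ge0 i : 0 <= tnth u i.
  have [id|di] := leqP i d.
    rewrite tnth_corner_lo //; have zi : (Ordinal n0 <= i)%N by [].
    have := psum_bounds t01 zi; rewrite psum0 // -natr1 /=; have := t01 (Ordinal n0); lra.
  rewrite tnth_corner_hi //; have := psum_bounds t01 (ltnW di); lra.
have u_cube : open_cube u.
  move=> i; rewrite lt_neqAle u_ge0 eq_sym u_neq0 /=.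
  have ud1 : tnth u d < 1 by rewrite ud -natr1; lra.
  apply: le_lt_trans ud1; have [id|di] := leqP i d; last exact: u_hid.
  by apply: u_lo; rewrite id leqnn.
have [w wu] := order_cell_exists u_cube u_neq.
have w_lt i j : tnth u i <= tnth u j -> i != j -> (w i < w j)%N.
  by move=> uij ij; rewrite -(order_cell_lt _ _ wu) lt_neqAle uij u_neq.
exists w => //; apply/corner_permsP; split=> [i j /andP[ij jd]|i j /andP[di ij]|i id].
- by apply: w_lt; [rewrite u_lo // jd ltnW|rewrite -(inj_eq val_inj) /= neq_ltn ij].
- by apply: w_lt; [rewrite u_hi // di ltnW|rewrite -(inj_eq val_inj) /= neq_ltn ij].
- apply: w_lt => //; have [le_id|di] := leqP i d; last exact: u_hid.
  by apply: u_lo; rewrite le_id leqnn.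
Qed.

Lemma measurable_corner : measurable corner.
Proof.
rewrite (_ : corner = slab d `&` [set t | d%:R < psum t d]) //.
apply: measurableI; first exact: measurable_slab.
apply: measurable_lt_fun => //; apply: measurable_sum => l.
by apply: measurable_funM => //; exact: measurable_tnth_real.
Qed.

(** The largest value sits at position [d], and the two blocks increase. Hence [w] is determined by
    the set of its values at the positions before [d], and this can be any set of [d] values other
    than the largest. *)
Lemma card_corner_perms : #|corner_perms| = 'C(n.-1, d).
Proof.
have n0 : (0 < n)%N by have := ltn_ord d; lia.
have ln : (n.-1 < n)%N by rewrite prednK.
pose top : 'I_n := Ordinal ln.
have le_top i : (i <= top)%N by have := ltn_ord i => /=; lia.
have lt_top i : i != top -> (i < top)%N.
  by rewrite -(inj_eq val_inj) /= => it; rewrite ltn_neqAle it; exact: le_top.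
pose f (w : 'S_n) : {set 'I_n} := [set w i | i : 'I_n in [set i : 'I_n | (i < d)%N]]%SET.
have W_top w : w \in corner_perms -> w d = top.
  move=> /corner_permsP[_ _ W3]; apply/eqP; apply: contraT => wd.
  have wt : (w^-1)%g top != d by apply: contra wd => /eqP <-; rewrite permKV.
  by have := W3 _ wt; rewrite permKV ltnNge le_top.
have f_mem (w : 'S_n) i : (w i \in f w) = (i < d)%N.
  by rewrite mem_imset ?inE //; exact: perm_inj.
have f_inj : {in corner_perms &, injective f}.
  move=> w w' Ww Ww' ff.
  (* [v] preserves the positions before [d], [d] itself and the positions after [d], and it is
     increasing; hence it is the identity. *)
  pose v : 'S_n := (w * w'^-1)%g.
  have vE i : w' (v i) = w i by rewrite permM permKV.
  have v_lo i : (v i < d)%N = (i < d)%N by rewrite -(f_mem w') vE -ff f_mem.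
  have v_d i : (v i == d) = (i == d).
    by rewrite -(inj_eq (@perm_inj _ w')) vE (W_top w') // -(W_top w) // (inj_eq (@perm_inj _ w)).
  have v_hi i : (d < v i)%N = (d < i)%N.
    have := v_lo i; have := v_d i; rewrite -!(inj_eq val_inj) /=.
    by case: (ltngtP (v i) d) => _; case: (ltngtP i d).
  have [W1 W2 W3] := corner_permsP _ Ww; have [W1' W2' W3'] := corner_permsP _ Ww'.
  have v_mono i j : (i < j)%N -> (v i < v j)%N.
    move=> ij; rewrite ltnNge; apply/negP => vji.
    have vij : (v j < v i)%N.
      rewrite ltn_neqAle vji andbT; apply/eqP => /val_inj/perm_inj ji.
      by move: ij; rewrite ji ltnn.
    have [jd|dj] := leqP j d.
      have vid : (v i <= d)%N by rewrite leqNgt v_hi -leqNgt (leq_trans (ltnW ij)).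
      have := W1' (v j) (v i); rewrite vij vid => /(_ isT); rewrite !vE.
      by have := W1 i j; rewrite ij jd => /(_ isT) h1 h2; have := ltn_trans h1 h2; rewrite ltnn.
    have [di|id] := ltnP d i.
      have := W2' (v j) (v i); rewrite vij v_hi dj => /(_ isT); rewrite !vE.
      by have := W2 i j; rewrite ij di => /(_ isT) h1 h2; have := ltn_trans h1 h2; rewrite ltnn.
    have := leq_ltn_trans id dj.
    move: id dj; rewrite -v_hi => id dj; rewrite leqNgt -v_hi -leqNgt in id.
    by have := leq_trans dj (leq_trans vji id); rewrite ltnn.
  have v_lt i j : (v i < v j)%N = (i < j)%N.
    have [ij|ji|/val_inj ->] := ltngtP i j; [exact: v_mono| |by rewrite ltnn].
    by apply/negbTE; rewrite -leqNgt ltnW // v_mono.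
  apply/permP => i; rewrite -vE; congr (w' _); apply: val_inj => /=.
  rewrite -(perm_rank v) -[RHS](@card_ord_lt n) 1?ltnW //.
  by apply: eq_card => j; rewrite !inE v_lt.
have f_im : [set f w | w in corner_perms]%SET
    = [set A : {set 'I_n} | (A \subset [set~ top]%SET) && (#|A| == d)]%SET.
  apply/setP => A; rewrite inE; apply/imsetP/andP => [[w Ww ->]|[At /eqP Ad]].
    split; last by rewrite card_imset ?card_ord_lt 1?ltnW //; exact: perm_inj.
    apply/fintype.subsetP => _ /imsetP[i + ->]; rewrite !inE -(W_top w) //.
    by rewrite (inj_eq (@perm_inj _ w)) -(inj_eq val_inj) /= neq_ltn => ->.
  have tA : top \notin A.
    by apply/negP => /(fintype.subsetP At); rewrite !inE eqxx.
  (* The keys list the values in the order of their positions: first [A] increasingly, then [top],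
     then the remaining values. Sorting gives the map from values to positions, whose inverse is the
     wanted permutation. *)
  pose key (k : 'I_n) : nat := if k \in A then k : nat else if k == top then n else (n.+1 + k)%N.
  have key_inj : injective key.
    move=> k l; rewrite /key; have := ltn_ord k; have := ltn_ord l.
    case: (k \in A); case: (l \in A); case: (k =P top) => [->|_]; case: (l =P top) => [->|_] ? ? kl;
      by [apply: val_inj | exfalso; lia | apply: val_inj => /=; lia].
  have [v vkey] := perm_of_key key_inj.
  have vkeyE i j : (v i < v j)%N = (key i < key j)%N by rewrite vkey ltEnat.
  have v_rank k : v k = #|[set l | (key l < key k)%N]%SET| :> nat.
    by rewrite -(perm_rank v); apply: eq_card => l; rewrite !inE vkeyE.
  have v_A k : (v k < d)%N = (k \in A).
    rewrite v_rank -Ad; apply/idP/idP => [|kA].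
      apply: contraTT => kA; rewrite -leqNgt; apply: subset_leq_card.
      apply/fintype.subsetP => l lA; rewrite inE /key lA (negbTE kA).
      by have := ltn_ord l; case: eqP => _; lia.
    apply: proper_card; apply/properP; split; last by exists k; rewrite ?inE ?ltnn.
    apply/fintype.subsetP => l; rewrite inE /key kA; case: ifP => // _.
    by have := ltn_ord k; case: eqP => _; lia.
  have v_top : v top = d :> nat.
    rewrite v_rank -Ad; apply: eq_card => l; rewrite inE /key (negbTE tA) eqxx.
    by case: (l \in A); rewrite ?ltn_ord //; case: (l == top); lia.
  have w_top : (v^-1)%g d = top by rewrite -(permK v top); congr (_ _); exact: val_inj.
  have w_lo i : (i < d)%N -> (v^-1)%g i \in A by rewrite -v_A permKV.
  have w_hi i : (d < i)%N -> ((v^-1)%g i \notin A) && ((v^-1)%g i != top).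
    move=> di; rewrite -v_A permKV -leqNgt ltnW //=.
    apply/eqP => h; move: di; rewrite -v_top -h permKV ltnn //.
  exists (v^-1)%g.
    apply/corner_permsP; split=> [i j /andP[ij jd]|i j /andP[di ij]|i id].
    - move: jd; rewrite leq_eqVlt => /orP[/eqP/val_inj jd|jd].
        rewrite jd w_top lt_top //; apply/eqP => h.
        by move: (w_lo i); rewrite -{1}jd ij h (negbTE tA) => /(_ isT).
      move: (ij); rewrite -{1}(permKV v i) -{1}(permKV v j) vkeyE /key.
      by rewrite w_lo ?w_lo // (ltn_trans ij).
    - have /andP[jA jt] := w_hi j (ltn_trans di ij); have /andP[iA it] := w_hi i di.
      move: (ij); rewrite -{1}(permKV v i) -{1}(permKV v j) vkeyE /key.
      by rewrite (negbTE jA) (negbTE jt) (negbTE iA) (negbTE it) ltn_add2l.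
    - rewrite w_top lt_top //; apply/eqP => h; move: id.
      by rewrite -(inj_eq val_inj) /= -v_top -h permKV eqxx.
  apply/setP => k; rewrite -{1}(permKV (v^-1)%g k) invgK.
  by rewrite -[in RHS](permK v k) f_mem v_A permK.
rewrite -(card_in_imset f_inj) f_im cards_draws.
by rewrite cardsC1 card_ord.
Qed.

Lemma lebesgue_corner : lebt corner = ((n`!)%:R^-1 * ('C(n.-1, d))%:R)%:E.
Proof.
rewrite mulr_natr -card_corner_perms.
have mco := (@coincident_null R n).1.
have mN := measurable_afft_preimage corner_mx corner_shift mco.
have N0 : lebt (afft corner_mx corner_shift @^-1` @coincident R n) = 0%E.
  rewrite lebesgue_tuple_affine ?det_corner_mx //; exact: (@coincident_null R n).2.
have mC w : measurable (corner_cell w).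
  by apply: measurable_afft_preimage; exact: measurable_order_cell.
apply: (@measure_equipartition _ _ _ (@lebesgue_tuple R n) _ _ _ _ _ corner_cell
  measurable_corner mN N0 mC).
- move=> w _; rewrite -(lebesgue_order_cell R w).
  apply: lebesgue_tuple_affine; last exact: measurable_order_cell.
  exact: det_corner_mx.
- exact: corner_cell_sub.
- by move=> w w' t _ _; exact: order_cell_inj.
- exact: corner_cell_cover.
Qed.

End Corner.

(** * The base polytope *)

Section Hulls.
Variables (R : realType) (m : nat).
Implicit Types (A : set 'rV[R]_m) (x y a b : 'rV[R]_m).

Lemma conv_hull_sub A x : A x -> conv_hull A x.
Proof.
move=> Ax; exists 1%N, (fun=> 1), (fun=> x); split => //.
- by rewrite big_ord1.
- by rewrite big_ord1 scale1r.
Qed.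

Lemma conv_hull_convex A x y (s t : R) : 0 <= s -> 0 <= t -> s + t = 1 ->
  conv_hull A x -> conv_hull A y -> conv_hull A (s *: x + t *: y).
Proof.
move=> s0 t0 st [k [c [v [Av c0 c1 ->]]]] [l [e [w [Aw e0 e1 ->]]]].
exists (k + l)%N, (fun i => match fintype.split i with inl i => s * c i | inr i => t * e i end),
  (fun i => match fintype.split i with inl i => v i | inr i => w i end).
have L (i : 'I_k) : fintype.split (lshift l i) = inl i by rewrite (unsplitK (inl i)).
have RR (i : 'I_l) : fintype.split (rshift k i) = inr i by rewrite (unsplitK (inr i)).
split.
- by move=> i; case: fintype.split.
- by move=> i; case: fintype.split => j; rewrite mulr_ge0.
- rewrite big_split_ord /=; under eq_bigr do rewrite L.
  under [X in _ + X]eq_bigr do rewrite RR.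
  by rewrite -!mulr_sumr c1 e1 !mulr1.
- rewrite big_split_ord /= !scaler_sumr; congr (_ + _); apply: eq_bigr => i _.
    by rewrite L scalerA.
  by rewrite RR scalerA.
Qed.

Lemma conv_hull_le A (f : 'I_m -> R) (b : R) x :
  (forall v, A v -> \sum_j f j * v ord0 j <= b) -> conv_hull A x ->
  \sum_j f j * x ord0 j <= b.
Proof.
move=> fA [k [c [v [Av c0 c1 ->]]]].
under eq_bigr => j _ do rewrite summxE mulr_sumr.
rewrite exchange_big /= -[leRHS]mul1r -c1 mulr_suml; apply: ler_sum => i _.
apply: le_trans (ler_wpM2l (c0 i) (fA _ (Av i))).
by rewrite mulr_sumr; apply: ler_sum => j _; rewrite mxE mulrCA.
Qed.

Lemma aff_hull_sub A x : A x -> aff_hull A x.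
Proof.
move=> Ax; exists 1%N, (fun=> 1), (fun=> x); split => //.
- by rewrite big_ord1.
- by rewrite big_ord1 scale1r.
Qed.

Lemma aff_hull_translate A x a b (s : R) : aff_hull A x -> A a -> A b ->
  aff_hull A (x + s *: (a - b)).
Proof.
move=> [k [c [v [Av c1 ->]]]] Aa Ab.
(* Two further points, [a] with coefficient [s] and [b] with coefficient [- s], leave the total
   weight equal to 1. *)
exists k.+2, (fun i => if unlift ord0 i is Some i' then
    if unlift ord0 i' is Some i'' then c i'' else - s else s),
  (fun i => if unlift ord0 i is Some i' then
    if unlift ord0 i' is Some i'' then v i'' else b else a).
split.
- by move=> i; case: unlift => // j; case: unlift.
- rewrite !big_ord_recl !unlift_none liftK unlift_none.
  under eq_bigr do rewrite !liftK.
  by rewrite c1 addNKr.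
- rewrite !big_ord_recl !unlift_none liftK unlift_none.
  under [X in _ = _ + (_ + X)]eq_bigr do rewrite !liftK.
  by rewrite addrA addrC scalerBr scaleNr.
Qed.

Lemma aff_hull_eq A (f : 'I_m -> R) (b : R) x :
  (forall v, A v -> \sum_j f j * v ord0 j = b) -> aff_hull A x ->
  \sum_j f j * x ord0 j = b.
Proof.
move=> fA [k [c [v [Av c1 ->]]]].
under eq_bigr => j _ do rewrite summxE mulr_sumr.
rewrite exchange_big /= -[RHS]mul1r -c1 mulr_suml; apply: eq_bigr => i _.
rewrite -(fA _ (Av i)) mulr_sumr; apply: eq_bigr => j _.
by rewrite mxE mulrCA.
Qed.

End Hulls.

Section Indicator.
Variables (R : realType) (m : nat).
Implicit Types (x : 'rV[R]_m) (S B : {set 'I_m}).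

Definition indicator B : 'rV[R]_m := \sum_(i in B) delta_mx ord0 i.

Lemma indicatorE B j : indicator B ord0 j = (j \in B)%:R.
Proof.
rewrite summxE; under eq_bigr do rewrite mxE eqxx /=.
have [jB|jB] := boolP (j \in B).
  rewrite (bigD1 j) //= eqxx big1 ?addr0 // => i /andP[_ ij].
  by rewrite eq_sym (negbTE ij).
rewrite big1 // => i iB; case: eqP => // ji.
by rewrite -ji (negbTE jB) in iB.
Qed.

Definition xsum x S : R := \sum_(i in S) x ord0 i.

Lemma xsumE x S : xsum x S = \sum_i (i \in S)%:R * x ord0 i.
Proof.
rewrite /xsum big_mkcond; apply: eq_bigr => i _.
by case: (i \in S); rewrite ?mul1r ?mul0r.
Qed.

Lemma xsum_setT x : xsum x finset.setT = \sum_i x ord0 i.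
Proof. by apply: eq_bigl => i; rewrite inE. Qed.

Lemma xsum_indicator S B : xsum (indicator B) S = #|S :&: B|%:R.
Proof.
rewrite -sum1_card natr_sum big_mkcond /= xsumE; apply: eq_bigr => i _.
by rewrite indicatorE inE; case: (i \in S); rewrite ?mul1r ?mul0r //=; case: (i \in B).
Qed.

Lemma xsumD x y S : xsum (x + y) S = xsum x S + xsum y S.
Proof. by rewrite -big_split; apply: eq_bigr => i _; rewrite mxE. Qed.

Lemma xsumZ (s : R) x S : xsum (s *: x) S = s * xsum x S.
Proof. by rewrite /xsum mulr_sumr; apply: eq_bigr => i _; rewrite mxE. Qed.

Lemma xsumUI x S S' : xsum x S + xsum x S' = xsum x (S :|: S') + xsum x (S :&: S').
Proof.
rewrite !xsumE -!big_split; apply: eq_bigr => i _; rewrite !inE.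
by case: (i \in S); case: (i \in S'); rewrite /= ?mul1r ?mul0r ?addr0 ?add0r.
Qed.

Definition edge_dir (i j : 'I_m) : 'rV[R]_m := delta_mx ord0 i - delta_mx ord0 j.

Lemma edge_dirE i j l : edge_dir i j ord0 l = (l == i)%:R - (l == j)%:R.
Proof. by rewrite !mxE eqxx. Qed.

Lemma xsum_edge_dir i j S : xsum (edge_dir i j) S = (i \in S)%:R - (j \in S)%:R.
Proof.
have delta l : \sum_k (k \in S)%:R * (k == l)%:R = (l \in S)%:R :> R.
  rewrite (bigD1 l) //= eqxx mulr1 big1 ?addr0 // => k /negbTE ->.
  by rewrite mulr0.
rewrite xsumE; under eq_bigr do rewrite edge_dirE mulrBr.
by rewrite sumrB !delta.
Qed.

End Indicator.

(** * Vertices of the cut hypersimplex *)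

Section Polytope.
Variables (R : realType) (m d : nat).
Variable H : {set {set 'I_m}}.
Hypothesis H_meet : forall S S', S \in H -> S' \in H -> S != S' -> (#|S :&: S'| < d)%N.
Implicit Types (x y : 'rV[R]_m) (S : {set 'I_m}).

Definition cut_hypersimplex : set 'rV[R]_m :=
  [set x : 'rV[R]_m | [/\ forall i, 0 <= x ord0 i <= 1, \sum_i x ord0 i = d.+1%:R
             & forall S, S \in H -> xsum x S <= d%:R]].

(** The sizes of this set and of [slack] add up to the induction measure: each edge step makes a
    coordinate integral or an inequality of [H] tight. *)
Let fractional x : {set 'I_m} := [set i | 0 < x ord0 i < 1]%SET.
Let slack x : {set {set 'I_m}} := [set S in H | xsum x S < d%:R]%SET.

(** Modularity gives x(S :&: S') at least 2d - (d + 1) = d - 1, while the intersection has at most d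
    - 1 elements with coordinates at most 1; all of these coordinates must equal 1. *)
Lemma tight_meet1 x S S' i : cut_hypersimplex x -> S \in H -> S' \in H -> S != S' ->
  xsum x S = d%:R -> xsum x S' = d%:R -> i \in S -> i \in S' -> x ord0 i = 1.
Proof.
move=> [x01 xT _] SH S'H SS' tS tS' iS iS'.
have U : xsum x (S :|: S') <= d.+1%:R.
  rewrite -xT xsumE; apply: ler_sum => j _; have /andP[? ?] := x01 j.
  by rewrite -[leRHS]mul1r ler_wpM2r //; case: (_ \in _); rewrite ?ler01.
have I1 : d%:R - 1 <= xsum x (S :&: S').
  have := xsumUI x S S'; rewrite tS tS' => h; move: U; rewrite -natr1; lra.
have I2 : \sum_(j in S :&: S') (1 - x ord0 j) = 0.
  apply/eqP; rewrite eq_le; apply/andP; split; last first.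
    by apply: sumr_ge0 => j _; rewrite subr_ge0; case/andP: (x01 j).
  rewrite sumrB sumr_const -/(xsum x (S :&: S')).
  have : (#|S :&: S'|).+1%:R <= d%:R :> R by rewrite ler_nat; exact: H_meet.
  by rewrite -natr1; lra.
have nn j : j \in S :&: S' -> 0 <= 1 - x ord0 j.
  by move=> _; rewrite subr_ge0; case/andP: (x01 j).
have iI : i \in S :&: S' by rewrite inE iS.
have := psumr_eq0P nn I2 iI; lra.
Qed.

(** An integral sum cannot have exactly one non-integral term. *)
Lemma fractional_partner x S a : cut_hypersimplex x -> xsum x S \is a Num.int ->
  a \in S -> a \in fractional x -> exists2 b, b \in S & (b \in fractional x) && (a != b).
Proof.
move=> [x01 _ _] Sint aS; rewrite inE => xa.
have [/exists_inP//|/exists_inPn none] :=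
  boolP [exists b in S, (b \in fractional x) && (a != b)].
exfalso.
have : x ord0 a \is a Num.int.
  have -> : x ord0 a = xsum x S - \sum_(b in S | b != a) x ord0 b.
    by rewrite /xsum (bigD1 a) //= addrK.
  apply: rpredB => //; apply: rpred_sum => b /andP[bS ba].
  have := none b bS; rewrite inE [a == b]eq_sym ba andbT => xb.
  have /andP[b0 b1] := x01 b; move: xb; rewrite !lt_neqAle b0 b1 !andbT.
  by rewrite negb_and !negbK => /orP[/eqP <-|/eqP ->]; rewrite ?rpred0 ?rpred1.
move/intrP => [z xz]; move: xa; rewrite xz ltr0z ltrz1; lia.
Qed.

(** If a fractional coordinate lies in a tight set [S], a partner exists inside [S], and no other
    tight set contains either, since shared coordinates equal 1. Otherwise no fractional coordinate
    lies in any tight set, and a partner comes from the integral total. *)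
Lemma fractional_pair x : cut_hypersimplex x -> fractional x != finset.set0 ->
  exists a b, [/\ a \in fractional x, b \in fractional x, a != b
    & forall S, S \in H -> xsum x S = d%:R -> (a \in S) = (b \in S)].
Proof.
move=> Qx /set0Pn[a0 fa0].
have [/existsP[S /exists_inP[a aS /and3P[fa SH /eqP tS]]]|none] :=
  boolP [exists S : {set 'I_m}, exists a in S,
    [&& a \in fractional x, S \in H & xsum x S == d%:R]].
  have [|b bS /andP[fb ab]] := fractional_partner Qx _ aS fa.
    by rewrite tS; exact: natr_int.
  exists a, b; split => // S' S'H tS'.
  have [->|SS'] := eqVneq S' S; first by rewrite aS bS.
  have notin e : e \in S -> e \in fractional x -> e \in S' = false.
    move=> eS; rewrite inE => /andP[_ e1]; apply/negP => eS'.
    rewrite eq_sym in SS'.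
    by rewrite (tight_meet1 Qx SH S'H SS' tS tS' eS eS') ltxx in e1.
  by rewrite !notin.
have [||b _ /andP[fb ab]] := @fractional_partner x finset.setT a0 Qx _ _ fa0.
- by rewrite xsum_setT; have [_ -> _] := Qx; exact: natr_int.
- by rewrite inE.
have notin S e : S \in H -> xsum x S = d%:R -> e \in fractional x -> e \in S = false.
  move=> SH tS fe; apply/negP => eS; move/negP: none; apply.
  by apply/existsP; exists S; apply/exists_inP; exists e; rewrite // fe SH tS eqxx.
by exists a0, b; split => // S SH tS; rewrite !(notin S).
Qed.

(** Tight inequalities are constant along the direction from [b] to [a], so a positive step is
    possible; the longest one makes a new inequality tight and keeps the old ones. *)
Lemma edge_step x a b : cut_hypersimplex x -> a \in fractional x -> b \in fractional x ->
  a != b -> (forall S, S \in H -> xsum x S = d%:R -> (a \in S) = (b \in S)) ->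
  exists2 s : R, 0 < s & let y := x + s *: edge_dir R a b in
    cut_hypersimplex y /\
    (#|fractional y| + #|slack y| < #|fractional x| + #|slack x|)%N.
Proof.
move=> Qx; rewrite !inE => /andP[a0 a1] /andP[b0 b1] ab tight.
have [x01 xT xS] := Qx.
(* The index [None] stands for the upper bound at [a] and the lower bound at [b]; [Some T] stands
   for a slack inequality whose left side grows. The step is the least of the resulting margins. *)
pose P (k : option {set 'I_m}) := if k is Some T then
  [&& T \in slack x, a \in T & b \notin T] else true.
pose g (k : option {set 'I_m}) : R := if k is Some T then d%:R - xsum x T
  else Num.min (1 - x ord0 a) (x ord0 b).
case: (@Order.TotalTheory.arg_minP _ _ _ None P g isT) => k Pk gmin.
set s := g k in gmin.
have s0 : 0 < s.
  rewrite /s /g; case: k Pk {gmin s} => [S /= /and3P[]|_].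
    by rewrite inE subr_gt0 => /andP[].
  by rewrite lt_min subr_gt0 a1.
have sE : (exists T : {set 'I_m}, [/\ T \in slack x, a \in T, b \notin T & s = d%:R - xsum x T])
    \/ s = Num.min (1 - x ord0 a) (x ord0 b).
  rewrite /s; case: k Pk {gmin s s0} => [T /and3P[? ? ?]|_]; last by right.
  by left; exists T.
have /= := gmin None isT; rewrite le_min => /andP[sa sb].
exists s => //=; set y := x + _.
have yE l : y ord0 l = x ord0 l + s * ((l == a)%:R - (l == b)%:R).
  by rewrite !mxE eqxx.
have ya : y ord0 a = x ord0 a + s by rewrite yE eqxx (negbTE ab) subr0 mulr1.
have yb : y ord0 b = x ord0 b - s.
  by rewrite yE eqxx eq_sym (negbTE ab) sub0r mulrN1.
have yl l : l != a -> l != b -> y ord0 l = x ord0 l.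
  by move=> la lb; rewrite yE (negbTE la) (negbTE lb) subrr mulr0 addr0.
have yS S : xsum y S = xsum x S + s * ((a \in S)%:R - (b \in S)%:R).
  by rewrite /y xsumD xsumZ xsum_edge_dir.
have slackP S : S \in H -> S \notin slack x -> xsum x S = d%:R.
  move=> SH; rewrite inE SH /= -leNgt => h; apply/eqP.
  by rewrite eq_le h andbT xS.
have Qy : cut_hypersimplex y.
  split.
  - move=> l; have [->|la] := eqVneq l a; first by rewrite ya; lra.
    have [->|lb] := eqVneq l b; first by rewrite yb; lra.
    by rewrite yl.
  - by rewrite -xsum_setT yS !inE subrr mulr0 addr0 xsum_setT.
  - move=> S SH; rewrite yS.
    have [Sx|Sx] := boolP (S \in slack x); last first.
      by rewrite (tight S) ?slackP // subrr mulr0 addr0.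
    have xSd := xS S SH.
    case aS: (a \in S); case bS: (b \in S); rewrite ?subrr ?mulr0 ?addr0 //.
      have := gmin (Some S); rewrite /P Sx aS bS => /(_ isT) /=.
      by rewrite subr0 mulr1; lra.
    by rewrite sub0r mulrN1; lra.
split => //.
have fsub : fractional y \subset fractional x.
  apply/fintype.subsetP => l; have [->|la] := eqVneq l a; first by rewrite !inE a0 a1.
  have [->|lb] := eqVneq l b; first by rewrite !inE b0 b1.
  by rewrite !inE yl.
have ssub : slack y \subset slack x.
  apply/fintype.subsetP => S; rewrite inE => /andP[SH Sy].
  apply: contraLR Sy => Sx; rewrite -leNgt yS (tight S) ?slackP //.
  by rewrite subrr mulr0 addr0.
have fle := subset_leq_card fsub; have sle := subset_leq_card ssub.
have [[l lx ly]|[S Sx Sy]] : (exists2 l, l \in fractional x & l \notin fractional y) \/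
    (exists2 S, S \in slack x & S \notin slack y).
  case: sE => [[S [Sx aS bS sE]]|sE].
    right; exists S => //; rewrite inE yS aS (negbTE bS) subr0 mulr1 sE.
    by rewrite addrC subrK ltxx andbF.
  left; move: sE; rewrite minEle; case: ifP => h sE.
    by exists a; rewrite !inE ?a0 ?a1 // ya sE addrC subrK ltxx andbF.
  by exists b; rewrite !inE ?b0 ?b1 // yb sE subrr ltxx.
- rewrite -addSn leq_add //; apply: proper_card; apply/properP; split => //.
  by exists l.
- rewrite -addnS leq_add //; apply: proper_card; apply/properP; split => //.
  by exists S.
Qed.

(** A point with a fractional coordinate lies between the ends of two opposite edge steps, both of
    smaller induction measure. A point without one is the indicator of a set of [d.+1] elements. *)
Lemma cut_hypersimplex_conv (V : set 'rV[R]_m) :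
  (forall B : {set 'I_m}, #|B| = d.+1 -> B \notin H -> V (indicator R B)) ->
  cut_hypersimplex `<=` conv_hull V.
Proof.
move=> VB x; have [k] := ubnP (#|fractional x| + #|slack x|)%N.
elim: k => // k IH in x *; rewrite ltnS => xk Qx.
have [f0|fn0] := eqVneq (fractional x) finset.set0.
  have [x01 xT xS] := Qx.
  pose B : {set 'I_m} := [set i | x ord0 i == 1]%SET.
  have xB : x = indicator R B.
    apply/rowP => i; rewrite indicatorE inE.
    have : i \notin fractional x by rewrite f0 inE.
    have /andP[x0 x1] := x01 i.
    rewrite inE !lt_neqAle x0 x1 !andbT negb_and !negbK eq_sym.
    by move=> /orP[/eqP ->|/eqP ->]; rewrite ?eqxx // eq_sym oner_eq0.
  have cB : #|B| = d.+1.
    apply/eqP; rewrite -(eqr_nat R) -xT -xsum_setT [in eqbRHS]xB xsum_indicator.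
    by rewrite finset.setTI.
  (* The indicator of a member of [H] with [d.+1] elements violates the inequality of that
     member. *)
  apply: conv_hull_sub; rewrite xB; apply: VB => //; apply/negP => BH.
  have := xS B BH; rewrite {1}xB xsum_indicator finset.setIid cB ler_nat.
  by rewrite ltnn.
have [a [b [fa fb ab tight]]] := fractional_pair Qx fn0.
have [s s0 [Qy ly]] := edge_step Qx fa fb ab tight.
have ba : b != a by rewrite eq_sym.
have [t t0 [Qz lz]] := edge_step Qx fb fa ba (fun S SH tS => esym (tight S SH tS)).
have st0 : 0 < s + t by rewrite addr_gt0.
(* The weights are inverse to the step lengths, so the opposite displacements cancel. *)
have -> : x = (t / (s + t)) *: (x + s *: edge_dir R a b)
            + (s / (s + t)) *: (x + t *: edge_dir R b a).
  apply/rowP => i; rewrite !mxE; field; exact: lt0r_neq0.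
apply: conv_hull_convex.
- by rewrite divr_ge0 // ltW.
- by rewrite divr_ge0 // ltW.
- by rewrite -mulrDl addrC divff // gt_eqF.
- by apply: IH => //; apply: leq_trans xk.
- by apply: IH => //; apply: leq_trans xk.
Qed.

End Polytope.

(** * Base polytopes of sparse paving matroids *)

Section BasePolytope.
Variables (R : realType) (n d : nat) (M : matroid 'I_n.+1).
Hypothesis M_rank : matroid_rank M = d.+1.
Hypothesis M_sparse : sparse_paving M.

Lemma circuit_hyperplanes_meet (S S' : {set 'I_n.+1}) :
  S \in circuit_hyperplanes M -> S' \in circuit_hyperplanes M -> S != S' ->
  (#|S :&: S'| < d)%N.
Proof.
rewrite !inE => hS hS' SS'; have := circuit_hyperplane_meet hS hS' SS'.
by rewrite M_rank addn2 ltnS.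
Qed.

(** Linear inequalities need checking only at bases, and a basis differs from each
    circuit-hyperplane of the same size, hence meets it in at most [d] elements. Conversely, by
    sparse paving, every set of [d.+1] elements outside the circuit-hyperplanes is a basis. *)
Lemma base_polytopeE :
  base_polytope R M = @cut_hypersimplex R n.+1 d (circuit_hyperplanes M).
Proof.
apply/seteqP; split => x; last first.
  apply: cut_hypersimplex_conv; first exact: circuit_hyperplanes_meet.
  move=> B cB BH; exists B => //; case: (M_sparse (S := B)) => //; first by rewrite M_rank.
  by move: BH; rewrite inE => /negP.
move=> Px.
have le_form (f : 'I_n.+1 -> R) b :
    (forall B, B \in bases M -> \sum_j f j * (j \in B)%:R <= b) -> \sum_j f j * x ord0 j <= b.
  move=> fb; apply: conv_hull_le Px => v [B bB ->].
  apply: le_trans (fb B bB); apply: ler_sum => j _.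
  by rewrite -/(indicator R B) indicatorE.
have coord (c : R) i (g : 'I_n.+1 -> R) : \sum_j (c * (j == i)%:R) * g j = c * g i.
  rewrite (bigD1 i) //= eqxx mulr1 big1 ?addr0 // => j /negbTE ->.
  by rewrite mulr0 mul0r.
have card_sum (c : R) (S B : {set 'I_n.+1}) :
    \sum_j (c * (j \in S)%:R) * (j \in B)%:R = c * #|S :&: B|%:R.
  rewrite -xsum_indicator xsumE mulr_sumr; apply: eq_bigr => j _.
  by rewrite indicatorE mulrA.
have all_sum (c : R) : \sum_j c * x ord0 j = c * \sum_j x ord0 j by rewrite mulr_sumr.
have card_all (c : R) (B : {set 'I_n.+1}) : B \in bases M ->
    \sum_j c * (j \in B)%:R = c * d.+1%:R.
  move=> bB; rewrite -mulr_sumr -M_rank -(basis_rank bB) -sum1_card natr_sum big_mkcond /=.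
  by congr (_ * _); rewrite [RHS]big_mkcond /=; apply: eq_bigr => j _; case: (j \in B).
split.
- move=> i; apply/andP; split.
    rewrite -oppr_le0; have := le_form (fun j => -1 * (j == i)%:R) 0.
    rewrite coord mulN1r; apply => B bB; rewrite coord mulN1r oppr_le0; exact: ler0n.
  have := le_form (fun j => 1 * (j == i)%:R) 1.
  by rewrite coord mul1r; apply => B bB; rewrite coord mul1r; case: (i \in B); rewrite ?ler01.
- apply/eqP; rewrite eq_le; apply/andP; split.
    have := le_form (fun=> 1) d.+1%:R; rewrite all_sum mul1r; apply => B bB.
    by rewrite card_all // mul1r.
  rewrite -lerN2; have := le_form (fun=> -1) (- d.+1%:R); rewrite all_sum mulN1r; apply => B bB.
  by rewrite card_all // mulN1r.
- move=> S; rewrite inE => hS.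
  have := le_form (fun j => 1 * (j \in S)%:R) d%:R.
  have -> : \sum_j 1 * (j \in S)%:R * x ord0 j = xsum x S.
    by rewrite xsumE; apply: eq_bigr => j _; rewrite mul1r.
  apply => B bB; rewrite card_sum mul1r ler_nat -ltnS -M_rank -(circuit_hyperplane_card hS).
  apply: proper_card; apply/properP; split; first exact: finset.subsetIl.
  have /subsetPn[j jS jB] : ~~ (S \subset B).
    apply: contra (circuit_hyperplane_not_basis hS) => SB.
    have -> // : S = B; apply/eqP; rewrite eqEcard SB (basis_rank bB).
    by rewrite (circuit_hyperplane_card hS) leqnn.
  by exists j; rewrite // inE (negbTE jB) andbF.
Qed.

(** If [d = n], the circuit would be the whole ground set, whose rank would then be one less than
    its size. The strict bound makes [d] a legitimate index in the corner computation. *)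
Lemma circuit_hyperplane_rank_le (S : {set 'I_n.+1}) : circuit_hyperplane M S -> (d < n)%N.
Proof.
move=> hS; have cS := circuit_hyperplane_card hS; rewrite M_rank in cS.
have := max_card (mem S); rewrite card_ord cS ltnS leq_eqVlt => /orP[/eqP dn|//].
have ST : S = finset.setT.
  by apply/eqP; rewrite eqEcard finset.subsetT cardsT card_ord cS dn leqnn.
have /andP[/circuit_rk] := hS; rewrite ST -/(matroid_rank M) M_rank cardsT card_ord dn.
lia.
Qed.

(** Connectedness realises every e_i - e_0 as a difference of two vertices, and these vectors span
    the directions of coordinate sum zero. *)
Lemma aff_hull_base_polytope : connected_matroid M ->
  aff_hull (base_polytope R M) = [set x : 'rV[R]_n.+1 | \sum_i x ord0 i = d.+1%:R].
Proof.
move=> conn; apply/seteqP; split => x.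
  move=> Ax; have := @aff_hull_eq _ _ _ (fun=> 1) d.+1%:R x _ Ax.
  under eq_bigr do rewrite mul1r.
  apply => v; rewrite base_polytopeE => -[_ vT _].
  by under eq_bigr do rewrite mul1r.
move=> /= xT.
have P_ind B : B \in bases M -> base_polytope R M (indicator R B).
  by move=> bB; apply: conv_hull_sub; exists B.
have [B0 bB0] := set0Pn _ (bases_neq0 M).
have vT : \sum_i indicator R B0 ord0 i = d.+1%:R.
  by rewrite -xsum_setT xsum_indicator finset.setTI (basis_rank bB0) M_rank.
pose z := x - indicator R B0.
have zT : \sum_i z ord0 i = 0.
  under eq_bigr do rewrite !mxE.
  by rewrite sumrB xT vT subrr.
(* The coordinate at [ord0] comes out right because those of [z] sum to zero. Summing over a list
   lets the directions be added one at a time. *)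
have -> : x = indicator R B0 + \sum_(i <- enum 'I_n.+1 | i != ord0) z ord0 i *: edge_dir R i ord0.
  apply/eqP; rewrite addrC -subr_eq -/z; apply/eqP/rowP => j.
  rewrite big_enum_cond /= summxE.
  under eq_bigr do rewrite mxE edge_dirE mulrBr.
  rewrite sumrB.
  have [->|j0] := eqVneq j ord0.
    rewrite big1 => [|i i0]; last by rewrite eq_sym (negbTE i0) mulr0.
    rewrite sub0r; under eq_bigr do rewrite mulr1.
    by move: zT; rewrite (bigD1 ord0) //= => /eqP; rewrite addr_eq0 => /eqP.
  rewrite (bigD1 j) //= eqxx mulr1 big1 => [|i /andP[_ ij]]; last first.
    by rewrite eq_sym (negbTE ij) mulr0.
  by rewrite big1 ?subr0 ?addr0 // => i _; rewrite mulr0.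
elim: (enum _) => [|i s IH]; first by rewrite big_nil addr0; apply: aff_hull_sub; exact: P_ind.
rewrite big_cons; case: ifP => // i0.
have [B bB [iB jB bB']] := connected_exchange conn i0.
rewrite addrCA addrC.
have -> : edge_dir R i ord0 = indicator R (i |: B :\ ord0) - indicator R B.
  apply/rowP => j; rewrite edge_dirE mxE [X in _ = _ + X]mxE !indicatorE !inE.
  have [->|ji] := eqVneq j i; first by rewrite (negbTE i0) (negbTE iB).
  have [->|j0] := eqVneq j ord0; first by rewrite jB.
  by rewrite /= !subrr.
by apply: aff_hull_translate; [exact: IH | exact: P_ind | exact: P_ind].
Qed.

End BasePolytope.

(** * Lattice frames *)

Section Frames.
Variables (R : realType) (n : nat) (r : R).
Hypothesis r_int : r \is a Num.int.

Definition sum_plane : set 'rV[R]_n.+1 := [set x | \sum_i x ord0 i = r].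

Definition ones : 'cV[R]_n.+1 := const_mx 1.
Definition dropl_mx : 'M[R]_(n.+1, n) := \matrix_(j, i) (j == lift ord_max i)%:R.
(** The rows form a basis of the integer vectors of coordinate sum zero, with the last coordinate as
    the dependent one; [dropl_mx] reads the parameters back. *)
Definition std_basis : 'M[R]_(n, n.+1) :=
  \matrix_(i, j) ((j == lift ord_max i)%:R - (j == ord_max)%:R).
Definition std_origin : 'rV[R]_n.+1 := r *: delta_mx ord0 ord_max.

Lemma sum_planeE (x : 'rV[R]_n.+1) : sum_plane x <-> x *m ones = r%:M.
Proof.
have E : (x *m ones) ord0 ord0 = \sum_i x ord0 i.
  by rewrite mxE; apply: eq_bigr => i _; rewrite mxE mulr1.
split=> [xr|xr]; first by apply/rowP => i; rewrite ord1 E xr !mxE mulr1n.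
by rewrite /sum_plane /= -E xr mxE mulr1n.
Qed.

Lemma affine_paramE k (p : 'rV[R]_n.+1) (B : 'M[R]_(k, n.+1)) t :
  affine_param p B t = p + rowt t *m B.
Proof.
by rewrite /affine_param mulmx_sum_row; congr (_ + _); apply: eq_bigr => i _; rewrite mxE.
Qed.

Lemma std_basis_dropl : std_basis *m dropl_mx = 1%:M.
Proof.
apply/matrixP => i j; rewrite !mxE (bigD1 (lift ord_max j)) //= !mxE eqxx mulr1.
rewrite big1 ?addr0 => [|l /negbTE lj]; last by rewrite !mxE lj mulr0.
rewrite (inj_eq (@lift_inj _ _)) eq_sym [lift _ _ == _]eq_sym (negbTE (neq_lift _ _)).
by rewrite subr0 eq_sym.
Qed.

Lemma dropl_std_basis : dropl_mx *m std_basis = 1%:M - ones *m delta_mx ord0 ord_max.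
Proof.
apply/matrixP => j l; rewrite mxE [in RHS]mxE [X in _ = _ + X]mxE [1%:M _ _]mxE.
rewrite [X in _ = _ - X]mxE big_ord1 !mxE eqxx mul1r /=.
under eq_bigr do rewrite !mxE.
case: (unliftP ord_max j) => [i ->|->].
  rewrite (bigD1 i) //= eqxx mul1r big1 ?addr0 => [|i' i'i]; last first.
    by rewrite (inj_eq (@lift_inj _ _)) eq_sym (negbTE i'i) mul0r.
  by rewrite [lift _ _ == l]eq_sym.
rewrite big1 => [|i _]; last by rewrite (negbTE (neq_lift _ _)) mul0r.
by rewrite [ord_max == l]eq_sym subrr.
Qed.

Lemma std_basis_ones : std_basis *m ones = 0.
Proof.
apply/colP => i; rewrite !mxE.
under eq_bigr do rewrite !mxE mulr1.
rewrite sumrB (bigD1 (lift ord_max i)) //= eqxx big1 ?addr0 => [|j /negbTE -> //].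
by rewrite (bigD1 ord_max) //= eqxx big1 ?addr0 ?subrr => [|j /negbTE -> //].
Qed.

Lemma dropl_std_basisK k (A : 'M[R]_(k, n.+1)) : A *m ones = 0 ->
  A *m dropl_mx *m std_basis = A.
Proof.
by move=> A0; rewrite -mulmxA dropl_std_basis mulmxBr mulmx1 mulmxA A0 mul0mx subr0.
Qed.

Lemma std_origin_plane : sum_plane std_origin.
Proof.
rewrite /sum_plane /= (bigD1 ord_max) //= !mxE !eqxx mulr1 big1 ?addr0 // => i /negbTE i0.
by rewrite !mxE i0 andbF mulr0.
Qed.

Definition int_mx k l (A : 'M[R]_(k, l)) := forall i j, A i j \is a Num.int.

Lemma int_mxM k l q (A : 'M[R]_(k, l)) (B : 'M[R]_(l, q)) :
  int_mx A -> int_mx B -> int_mx (A *m B).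
Proof. by move=> iA iB i j; rewrite mxE rpred_sum // => e _; rewrite rpredM. Qed.

Lemma int_mxD k l (A B : 'M[R]_(k, l)) : int_mx A -> int_mx B -> int_mx (A + B).
Proof. by move=> iA iB i j; rewrite mxE rpredD. Qed.

Lemma int_std_basis : int_mx std_basis.
Proof. by move=> i j; rewrite mxE rpredB ?natr_int. Qed.

Lemma int_dropl : int_mx dropl_mx.
Proof. by move=> i j; rewrite mxE natr_int. Qed.

(** The two determinants are integers with product 1. *)
Lemma int_mx_det_unit k (U V : 'M[R]_k) : int_mx U -> int_mx V -> U *m V = 1%:M ->
  `|\det U| = 1.
Proof.
have int_det (A : 'M[R]_k) : int_mx A -> \det A \is a Num.int.
  move=> iA; rewrite rpred_sum // => s _; rewrite rpredMsign.
  by rewrite rpred_prod.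
move=> /int_det/intrP[u uE] /int_det/intrP[v vE] UV.
have /intr_inj uv1 : (u * v)%:~R = 1%:~R :> R.
  by rewrite intrM -uE -vE -det_mulmx UV det1.
have : (`|u| * `|v| = 1)%N by rewrite -abszM uv1.
move/eqP; rewrite muln_eq1 => /andP[/eqP u1 _].
by rewrite uE -intr_norm -abszE u1.
Qed.

Lemma std_lattice_frame : lattice_frame sum_plane std_origin std_basis.
Proof.
have into (t : n.-tuple R) : sum_plane (affine_param std_origin std_basis t).
  apply/sum_planeE; rewrite affine_paramE mulmxDl -mulmxA std_basis_ones mulmx0 addr0.
  exact/sum_planeE/std_origin_plane.
have onto x : sum_plane x ->
    affine_param std_origin std_basis (tupr ((x - std_origin) *m dropl_mx)) = x.
  move=> /sum_planeE xr; rewrite affine_paramE tuprK dropl_std_basisK; first by rewrite addrC subrK.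
  by rewrite mulmxBl xr (sum_planeE _).1 ?subrr //; exact: std_origin_plane.
have int_o : int_mx std_origin.
  by move=> i j; rewrite !mxE rpredM ?natr_int.
split.
- by apply/row_freeP; exists dropl_mx; exact: std_basis_dropl.
- apply/seteqP; split => [_ [t _ <-]|x xr]; first exact: into.
  by exists (tupr ((x - std_origin) *m dropl_mx)) => //; exact: onto.
- apply/seteqP; split => [_ [t ti <-]|x [xr xi]].
    split; first exact: into.
    move=> j; rewrite affine_paramE; apply: int_mxD => //; apply: int_mxM.
      by move=> i l; rewrite mxE.
    exact: int_std_basis.
  exists (tupr ((x - std_origin) *m dropl_mx)); last exact: onto.
  move=> i; rewrite tnth_mktuple; apply: int_mxM; last exact: int_dropl.
  by move=> e j; rewrite mxE [X in _ + X]mxE rpredB // [e]ord1.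
Qed.

(** The origin and the rows of [B] are integral, so [B] has integral coordinates [U] in the standard
    frame. Conversely the lattice condition writes each standard vector integrally in [B], which
    gives [V]. Being inverse to each other, [U] and [V] are square. *)
Lemma lattice_frame_std k (p : 'rV[R]_n.+1) (B : 'M[R]_(k, n.+1)) :
  lattice_frame sum_plane p B ->
  k = n /\ exists (U : 'M[R]_(k, n)) (V : 'M[R]_(n, k)) (c : 'rV[R]_n),
    [/\ int_mx U, int_mx V, U *m V = 1%:M
      & forall t, affine_param p B t = affine_param std_origin std_basis (afft U c t)].
Proof.
move=> [freeB imB latB].
have into t : sum_plane (affine_param p B t) by rewrite -imB; exists t.
have into_int (t : k.-tuple R) : (forall i, tnth t i \is a Num.int) ->
    int_mx (affine_param p B t).
  move=> ti; have [_ h] : (sum_plane `&` @lattice_points R n.+1) (affine_param p B t).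
    by rewrite -latB; exists t.
  by move=> i j; rewrite ord1; exact: h.
have param0 : affine_param p B (tupr 0) = p by rewrite affine_paramE tuprK mul0mx addr0.
have param1 i : affine_param p B (tupr (delta_mx ord0 i)) = p + row i B.
  by rewrite affine_paramE tuprK -rowE.
have p_plane : sum_plane p by rewrite -param0; exact: into.
have p_int : int_mx p.
  by rewrite -param0; apply: into_int => i; rewrite tnth_mktuple mxE rpred0.
have B_ones : B *m ones = 0.
  apply/row_matrixP => i; rewrite row_mul row0.
  have /sum_planeE := into (tupr (delta_mx ord0 i)).
  rewrite param1 mulmxDl ((sum_planeE _).1 p_plane) => /eqP.
  by rewrite addrC -subr_eq0 addrK => /eqP.
have B_int : int_mx B.
  move=> i j; have -> : B i j = (affine_param p B (tupr (delta_mx ord0 i)) - p) ord0 j.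
    by rewrite param1 addrC addKr mxE.
  rewrite mxE [X in _ + X]mxE rpredB //; apply: into_int => l.
  by rewrite tnth_mktuple mxE natr_int.
(* Translating [p] by a standard vector gives a lattice point of the plane, hence the image of an
   integral parameter. *)
have /choice[f fP] (i : 'I_n) : exists t : k.-tuple R,
    (forall l, tnth t l \is a Num.int) /\ rowt t *m B = row i std_basis.
  have : (sum_plane `&` @lattice_points R n.+1) (p + row i std_basis).
    split.
      apply/sum_planeE; rewrite mulmxDl -row_mul std_basis_ones row0 addr0.
      exact/sum_planeE.
    by move=> j; rewrite mxE [X in _ + X]mxE rpredD //; exact: int_std_basis.
  rewrite -latB => -[t ti tE]; exists t; split => //.
  by apply: (addrI p); rewrite -affine_paramE.
pose V : 'M[R]_(n, k) := \matrix_(i, l) tnth (f i) l.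
have VB : V *m B = std_basis.
  apply/row_matrixP => i; rewrite row_mul -(fP i).2; congr (_ *m _).
  by apply/rowP => l; rewrite !mxE.
pose U := B *m dropl_mx.
have UB : U *m std_basis = B by exact: dropl_std_basisK.
have VU : V *m U = 1%:M by rewrite mulmxA VB std_basis_dropl.
have UV : U *m V = 1%:M.
  by apply: (row_free_inj freeB); rewrite -mulmxA VB UB mul1mx.
split; first by apply/eqP; rewrite eqn_leq (mulmx1_min UV) (mulmx1_min VU).
exists U, V, ((p - std_origin) *m dropl_mx); split => //.
- exact: int_mxM int_dropl.
- by move=> i l; rewrite mxE; exact: (fP i).1.
- move=> t; rewrite !affine_paramE tuprK mulmxDl -mulmxA UB dropl_std_basisK.
    by rewrite [rowt t *m B + _]addrC addrA [_ + (p - _)]addrC subrK.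
  by rewrite mulmxBl ((sum_planeE _).1 p_plane) (sum_planeE _).1 ?subrr //; exact: std_origin_plane.
Qed.

Lemma lattice_frame_volume k (p : 'rV[R]_n.+1) (B : 'M[R]_(k, n.+1)) (P : set 'rV[R]_n.+1) :
  lattice_frame sum_plane p B ->
  measurable (affine_param std_origin std_basis @^-1` P) ->
  lebesgue_tuple (affine_param p B @^-1` P)
    = lebesgue_tuple (affine_param std_origin std_basis @^-1` P).
Proof.
move=> /lattice_frame_std[kn [U [V [c [iU iV UV pE]]]]] mP; subst k.
rewrite -[RHS](@lebesgue_tuple_affine R n U c) //; last exact: int_mx_det_unit iU iV UV.
by congr lebesgue_tuple; apply/seteqP; split => t /=; rewrite pE.
Qed.

(** Permuting coordinates preserves both the plane and its lattice. This reduces the corner of an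
    arbitrary circuit-hyperplane to that of an initial segment. *)
Lemma lattice_frame_perm k (p : 'rV[R]_n.+1) (B : 'M[R]_(k, n.+1)) (s : 'S_n.+1) :
  lattice_frame sum_plane p B ->
  lattice_frame sum_plane (p *m perm_mx s) (B *m perm_mx s).
Proof.
have permE (x : 'rV[R]_n.+1) j : (x *m perm_mx s) ord0 j = x ord0 ((s^-1)%g j).
  by rewrite -[s in perm_mx s]invgK -col_permE mxE.
have perm_plane (x : 'rV[R]_n.+1) : sum_plane (x *m perm_mx s) <-> sum_plane x.
  have E : \sum_i (x *m perm_mx s) ord0 i = \sum_i x ord0 i.
    rewrite [RHS](reindex_inj (@perm_inj _ (s^-1)%g)).
    by apply: eq_bigr => i _; exact: permE.
  by rewrite /sum_plane /= E.
have perm_lat (x : 'rV[R]_n.+1) : lattice_points (x *m perm_mx s) <-> lattice_points x.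
  split=> h j; last by rewrite permE.
  by have := h (s j); rewrite permE permK.
have paramE t : affine_param (p *m perm_mx s) (B *m perm_mx s) t = affine_param p B t *m perm_mx s.
  by rewrite !affine_paramE mulmxDl mulmxA.
have permK' (x : 'rV[R]_n.+1) : x *m perm_mx (s^-1)%g *m perm_mx s = x.
  by rewrite -mulmxA -perm_mxM mulVg perm_mx1 mulmx1.
move=> [freeB imB latB]; split.
- by rewrite /row_free mxrankMfree // row_free_unit unitmx_perm.
- apply/seteqP; split => [_ [t _ <-]|x xr].
    by rewrite paramE; apply/perm_plane; rewrite -imB; exists t.
  have : sum_plane (x *m perm_mx (s^-1)%g) by apply/perm_plane; rewrite permK'.
  by rewrite -imB => -[t _ tE]; exists t => //; rewrite paramE tE permK'.
- apply/seteqP; split => [_ [t ti <-]|x [xr xi]].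
    have : (sum_plane `&` @lattice_points R n.+1) (affine_param p B t).
      by rewrite -latB; exists t.
    by rewrite paramE => -[? ?]; split; [exact/perm_plane | exact/perm_lat].
  have : (sum_plane `&` @lattice_points R n.+1) (x *m perm_mx (s^-1)%g).
    by split; [apply/perm_plane | apply/perm_lat]; rewrite permK'.
  by rewrite -latB => -[t ti tE]; exists t => //; rewrite paramE tE permK'.
Qed.

End Frames.

(** * The volume *)

Section Volumes.
Variables (R : realType) (n d : nat).
Local Notation lebt := (@lebesgue_tuple R).
Local Notation param := (affine_param (std_origin n (d.+1%:R : R)) (std_basis R n)).
Implicit Types (t : n.-tuple R) (S : {set 'I_n.+1}).

Lemma param_lift t i : param t ord0 (lift ord_max i) = tnth t i.
Proof.
rewrite affine_paramE mxE [std_origin _ _ _ _]mxE [delta_mx _ _ _ _]mxE eqxx /=.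
rewrite [lift _ _ == _]eq_sym (negbTE (neq_lift _ _)) mulr0 add0r mxE.
rewrite -[RHS]sum_tnth_delta; apply: eq_bigr => l _; rewrite !mxE.
rewrite [_ == ord_max]eq_sym (negbTE (neq_lift _ _)) subr0 (inj_eq (@lift_inj _ _)).
by rewrite [i == l]eq_sym.
Qed.

Lemma param_sum t : \sum_i param t ord0 i = d.+1%:R.
Proof.
have [_ im _] := @std_lattice_frame R n d.+1%:R (natr_int _ _).
have : sum_plane (d.+1%:R : R) (param t) by rewrite -im; exists t.
by [].
Qed.

Lemma param_max t : param t ord0 ord_max = d.+1%:R - \sum_i tnth t i.
Proof.
have := param_sum t; rewrite (bigD1_ord ord_max) //=.
under eq_bigr do rewrite param_lift.
by move=> h; apply/eqP; rewrite eq_sym subr_eq; apply/eqP/esym.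
Qed.

(** The two bounds on the sum of [t] are the bounds on the dependent last coordinate. *)
Lemma slab_param t : slab d t <-> forall i, 0 <= param t ord0 i <= 1.
Proof.
split=> [[t01 td] i|h].
  case: (unliftP ord_max i) => [j ->|->]; first by rewrite param_lift.
  by rewrite param_max -natr1; move: td; rewrite -natr1; lra.
split=> [i|]; first by have := h (lift ord_max i); rewrite param_lift.
by have := h ord_max; rewrite param_max -natr1; lra.
Qed.

(** The condition on the total sum is left to the parametrisation. *)
Definition cut_corner S : set 'rV[R]_n.+1 :=
  [set x : 'rV[R]_n.+1 | (forall i, 0 <= x ord0 i <= 1) /\ d%:R < xsum x S].

Lemma measurable_param_coord i : measurable_fun setT (fun t => param t ord0 i).
Proof.
have := @measurable_linear_form R n (fun l => std_basis R n l i)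
  (std_origin n (d.+1%:R : R) ord0 i).
apply: eq_measurable_fun => t _; rewrite affine_paramE [RHS]mxE [RHS]addrC; congr (_ + _).
by rewrite [RHS]mxE; apply: eq_bigr => l _; rewrite [rowt _ _ _]mxE.
Qed.

Lemma measurable_param_xsum S : measurable_fun setT (fun t => xsum (param t) S).
Proof.
have : measurable_fun setT (fun t => \sum_i (i \in S)%:R * param t ord0 i).
  by apply: measurable_sum => i; apply: measurable_funM => //; exact: measurable_param_coord.
by apply: eq_measurable_fun => t _; rewrite xsumE.
Qed.

Lemma cut_cornerE S : param @^-1` cut_corner S = @slab R n d `&` [set t | d%:R < xsum (param t) S].
Proof.
by apply/seteqP; split => t /= [h1 h2]; split => //; exact/slab_param.
Qed.

Lemma measurable_cut_corner S : measurable (param @^-1` cut_corner S).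
Proof.
rewrite cut_cornerE; apply: measurableI; first exact: measurable_slab.
by apply: measurable_lt_fun => //; exact: measurable_param_xsum.
Qed.

(** A permuted standard frame moves [S] to the first [d.+1] coordinates, where the piece is
    literally [corner]; all lattice frames compute the same volume. *)
Lemma lebesgue_cut_corner S : (d < n)%N -> #|S| = d.+1 ->
  lebt (param @^-1` cut_corner S) = ((n`!)%:R^-1 * ('C(n.-1, d))%:R)%:E.
Proof.
move=> dn cS; have [w wS] := perm_onto_prefix S; rewrite cS in wS.
have frame := lattice_frame_perm (w^-1)%g (@std_lattice_frame R n d.+1%:R (natr_int _ _)).
rewrite -(lattice_frame_volume frame (measurable_cut_corner S)).
rewrite -(lebesgue_corner R (Ordinal dn)); congr lebesgue_tuple.
have paramE t j : affine_param (std_origin n (d.+1%:R : R) *m perm_mx (w^-1)%g)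
    (std_basis R n *m perm_mx (w^-1)%g) t ord0 j = param t ord0 (w j).
  by rewrite !affine_paramE mulmxA -mulmxDl -col_permE mxE.
have sumE t : xsum (affine_param (std_origin n (d.+1%:R : R) *m perm_mx (w^-1)%g)
    (std_basis R n *m perm_mx (w^-1)%g) t) S = psum t d.
  rewrite xsumE; under eq_bigr do rewrite paramE -wS.
  transitivity (\sum_(j < n.+1) (j < d.+1)%N%:R * param t ord0 j).
    by rewrite [RHS](reindex_inj (@perm_inj _ w)).
  (* Since [d < n], the dependent last coordinate lies outside the prefix. *)
  rewrite (bigD1_ord ord_max) //= ltnS leqNgt dn mul0r add0r /psum.
  apply: eq_bigr => i _; rewrite param_lift mulrC; congr (_ * _%:R).
  by rewrite ltnS (_ : bump n i = i) // /bump leqNgt ltn_ord.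
apply/seteqP; split => t; rewrite /preimage /= => -[h1 h2].
  split; last by rewrite -sumE.
  apply/slab_param => i; have := h1 ((w^-1)%g i).
  by rewrite paramE permKV.
split; last by rewrite sumE.
by move=> i; rewrite paramE; move/slab_param: h1; exact.
Qed.

(** The complement in the slab is the union of the cut corners. Two of them are disjoint: at a
    common point x(S) + x(S') would exceed 2d, but it is at most d + 1 for the union plus d - 1 for
    the intersection. *)
Lemma lebesgue_cut_hypersimplex (H : {set {set 'I_n.+1}}) : (0 < n)%N ->
  (forall S, S \in H -> #|S| = d.+1) -> (forall S, S \in H -> (d < n)%N) ->
  (forall S S', S \in H -> S' \in H -> S != S' -> (#|S :&: S'| < d)%N) ->
  measurable (param @^-1` cut_hypersimplex d H) /\
  lebt (param @^-1` cut_hypersimplex d H) =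
    ((n`!)%:R^-1 * ((eulerian n d)%:R - #|H|%:R * ('C(n.-1, d))%:R))%:E.
Proof.
move=> n0 Hc Hd Hm; set P := param @^-1` _.
have PE : P = @slab R n d `&` [set t | forall S, S \in H -> xsum (param t) S <= d%:R].
  apply/seteqP; split => t /=; first by move=> [h1 _ h3]; split => //; exact/slab_param.
  move=> [/slab_param h1 h3]; split => //; exact: param_sum.
have mP : measurable P.
  rewrite PE; apply: measurableI; first exact: measurable_slab.
  apply: measurable_forall => S; apply: measurable_imply.
  by apply: measurable_le_fun => //; exact: measurable_param_xsum.
split => //.
have mD : measurable (@slab R n d `\` P) by apply: measurableD => //; exact: measurable_slab.
pose c : R := (n`!)%:R^-1 * ('C(n.-1, d))%:R.
have DE : lebt (@slab R n d `\` P) = (c *+ #|H|)%:E.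
  apply: (@measure_equipartition _ _ _ (@lebesgue_tuple R n) _ H c _ set0
    (fun S => param @^-1` cut_corner S) mD).
  - exact: measurable0.
  - exact: measure0.
  - exact: measurable_cut_corner.
  - by move=> S SH; apply: lebesgue_cut_corner; [exact: (Hd S) | exact: Hc].
  - move=> S SH t; rewrite cut_cornerE => -[st lt]; split => // -[_ _ /(_ S SH)].
    by rewrite leNgt lt.
  - move=> S S' t SH S'H; rewrite !cut_cornerE => -[st lt] [_ lt'].
    apply/eqP; apply: contraT => SS'.
    have := xsumUI (param t) S S'.
    have U : xsum (param t) (S :|: S') <= d.+1%:R.
      rewrite -[leRHS](param_sum t) xsumE; apply: ler_sum => j _.
      have /andP[? ?] := (slab_param t).1 st j.
      by rewrite -[leRHS]mul1r ler_wpM2r //; case: (_ \in _); rewrite ?ler01.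
    have I : xsum (param t) (S :&: S') <= d%:R - 1.
      have : (#|S :&: S'|).+1%:R <= d%:R :> R by rewrite ler_nat; exact: Hm.
      suff : xsum (param t) (S :&: S') <= #|S :&: S'|%:R by rewrite -natr1; lra.
      rewrite -sum1_card natr_sum; apply: ler_sum => j _.
      by have /andP[] := (slab_param t).1 st j.
    have d1 : d.+1%:R = d%:R + 1 :> R by rewrite natr1.
    by move: lt lt' => /= lt lt'; lra.
  - move=> t [st nP] _; apply: contrapT => none; apply: nP; rewrite PE; split => // S SH.
    rewrite leNgt; apply/negP => lt; apply: none; exists S => //.
    by rewrite cut_cornerE.
have slabP : @slab R n d `&` P = P by rewrite PE setIA setIid.
have : lebt (@slab R n d) = (lebt (@slab R n d `\` P) + lebt P)%E.
  rewrite -[X in (_ + lebt X)%E]slabP.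
  exact: (measureDI (@lebesgue_tuple R n) (@measurable_slab R n d) mP).
rewrite lebesgue_slab // DE.
(* The slab has finite volume, which excludes infinite values for [P]. *)
case: (lebt P) => [v| |] //= -[vE]; congr EFin.
move: vE; rewrite -[c *+ #|H|]mulr_natr => vE; rewrite mulrBr vE /c.
ring.
Qed.

End Volumes.

Theorem theorem1p2 (R : realType) (n d alpha : nat) (M : matroid 'I_n.+1)
    (n_ge1 : (1 <= n)%N) (d_ge1 : (1 <= d)%N)
    (M_connected : connected_matroid M)
    (M_sparse_paving : sparse_paving M)
    (M_rank : matroid_rank M = d.+1)
    (M_alpha : #|circuit_hyperplanes M| = alpha) :
  Vol (base_polytope R M) =
    ((n`!)%:R^-1 * ((eulerian n d)%:R - alpha%:R * ('C(n.-1, d))%:R))%:E.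
Proof.
have affE := aff_hull_base_polytope R M_rank M_sparse_paving M_connected.
have [||| mP volP] := @lebesgue_cut_hypersimplex R n d (circuit_hyperplanes M) n_ge1.
- by move=> S; rewrite inE => /circuit_hyperplane_card ->.
- by move=> S; rewrite inE; exact: circuit_hyperplane_rank_le.
- exact: circuit_hyperplanes_meet.
rewrite -M_alpha -volP /Vol affE (base_polytopeE R M_rank M_sparse_paving).
(* The standard frame supplies a value and every other frame yields the same one, so the choice in
   [Vol] is determined. *)
apply: xget_unique.
  exists n, (std_origin n (d.+1%:R : R)), (std_basis R n); split => //.
  exact: std_lattice_frame (natr_int _ _).
move=> v [k [p [B [frame ->]]]].
exact: (lattice_frame_volume frame mP).
Qed.
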